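(* Let $X$ and $Y$ be Banach spaces, $\Omega\subset X$ and $F:X\rightrightarrows Y$ be such that $\Omega$ and $\mathrm{gph}\,F$ are closed, $\bar x\in\Omega$, $\bar y\in F(\bar x)$, and $\delta>0$. Suppose that a mapping $L:Y\rightrightarrows Y$ satisfies conditions (O1) and (O5) at $\bar y$. If condition $(QC)_C$ is satisfied and $(\bar x,\bar y)$ is extremal for $F$ on $\Omega$ (with respect to $L$), then there is an $M>0$ such that, for any $\varepsilon>0$, there exist $(x_1,y_1)\in\mathrm{gph}\,F\cap B_{\varepsilon}(\bar x,\bar y)$, $x_2\in\Omega\cap B_{\varepsilon}(\bar x)$, $y\in L^-(\bar y)\cap B_\delta(\bar y)$, $y_2\in\mathrm{cl}\,L(y)\cap B_\varepsilon(\bar y)$, and $y^*\in N^C_{\mathrm{cl}\,L(y)}(y_2)+\varepsilon\mathbb B_{Y^*}$ such that $\|y^*\|=1$ and $$0\in D^{*C}F(x_1,y_1)(y^* )+N^C_\Omega(x_2)\cap(M\mathbb B_{X^*})+\varepsilon\mathbb B_{X^*}.$$ If $X$ and $Y$ are Asplund, condition $(QC)_F$ is satisfied (in place of $(QC)_C$) and $(\bar x,\bar y)$ is extremal for $F$ on $\Omega$ (with respect to $L$), then there is an $M>0$ such that, for any $\varepsilon>0$, there exist $(x_1,y_1)\in\mathrm{gph}\,F\cap B_{\varepsilon}(\bar x,\bar y)$, $x_2\in\Omega\cap B_{\varepsilon}(\bar x)$, $y\in L^-(\bar y)\cap B_\delta(\bar y)$, $y_2\in\mathrm{cl}\,L(y)\cap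 B_\varepsilon(\bar y)$, and $y^*\in N^F_{\mathrm{cl}\,L(y)}(y_2)+\varepsilon\mathbb B_{Y^*}$ such that $\|y^*\|=1$ and $$0\in D^{*F}F(x_1,y_1)(y^* )+N^F_\Omega(x_2)\cap(M\mathbb B_{X^*})+\varepsilon\mathbb B_{X^*}.$$
   Context: Notation: $B_\delta(x)$ is the open ball ($B_{+\infty}(x)$ is the whole space); $\mathbb B$ (with a subscript for the space) is the open unit ball; $X\times Y$ carries the maximum norm; $d(x,S)=\inf_{u\in S}\|u-x\|$ with $d(x,\emptyset)=+\infty$; $\mathrm{gph}\,F=\{(x,y)\mid y\in F(x)\}$ for a set-valued mapping $F$ (values may be empty); the image of a set under a set-valued mapping is the union of the images of its points. Normal cones: for a subset $S$ of a normed space $Z$ and $\bar z\in S$, the Fréchet normal cone is $N^F_S(\bar z)=\{z^*\in Z^*\mid \limsup_{S\ni z\to\bar z,\,z\ne\bar z}\langle z^*,z-\bar z\rangle/\|z-\bar z\|\le0\}$; the Clarke tangent cone $T^C_S(\bar z)$ is the set of $w\in Z$ such that for all $z_k\to\bar z$ with $z_k\in S$ and all $t_k\downarrow0$ there are $w_k\to w$ with $z_k+t_kw_k\in S$ for all $k$; the Clarke normal cone is $N^C_S(\bar z)=\{z^*\in Z^*\mid\langle z^*,w\rangle\le0\ \forall w\in T^C_S(\bar z)\}$. Both are empty by convention if $\bar z\notin S$. Coderivatives: for $(x,y)\in\mathrm{gph}\,F$, $D^{*C}F(x,y)(y^* )=\{x^*\in X^*\mid(x^*,-y^* )\in N^C_{\mathrm{gph}\,F}(x,y)\}$,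 and $D^{*F}F(x,y)$ is defined in the same way with $N^F$ in place of $N^C$. A Banach space is Asplund if the dual of each of its separable subspaces is separable. Condition $(QC)_C$: there is an $\varepsilon>0$ such that $\|x_1^*+x_2^*\|\ge\varepsilon$ for all $(x_1,y_1)\in\mathrm{gph}\,F\cap B_{\varepsilon}(\bar x,\bar y)$, $x_2\in\Omega\cap B_{\varepsilon}(\bar x)$, $x_1^*\in D^{*C}F(x_1,y_1)(\varepsilon\mathbb B_{Y^*})$ and $x_2^*\in N^C_\Omega(x_2)$ such that $\|x_1^*\|+\|x_2^*\|=1$. Condition $(QC)_F$ is the same with $N^F$ and $D^{*F}$ in place of $N^C$ and $D^{*C}$. Level-set mapping: for $L:Y\rightrightarrows Y$, set $L^\circ(y):=L(y)\setminus\{y\}$ and $L^-(y):=L(y)\cup\{y\}$. Condition (O1): $\liminf_{L^\circ(\bar y)\ni y\to\bar y}d(\bar y,L(y))=0$ (in particular $\bar y\in\mathrm{cl}\,L^\circ(\bar y)$; the lower limit over an empty set is $+\infty$). Condition (O5): if $y\in L^\circ(\bar y)$ and $v\in\mathrm{cl}\,L(y)$, then $v\in L^\circ(\bar y)$. The point $(\bar x,\bar y)$ is extremal for $F$ on $\Omega$ if there is a $\rho\in(0,+\infty]$ such that $F(\Omega\cap B_\rho(\bar x))\cap L^\circ(\bar y)\cap B_\rho(\bar y)=\emptyset$. *)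

(* Defs.v *)
From HB Require Import structures.
From mathcomp Require Import all_boot all_order all_algebra.
From mathcomp Require Import all_classical all_reals all_analysis.

Set Implicit Arguments.
Unset Strict Implicit.
Unset Printing Implicit Defensive.

Import Order.TTheory GRing.Theory Num.Theory.
Import numFieldNormedType.Exports.

Local Open Scope classical_set_scope.
Local Open Scope ring_scope.

Section dual_space.
Context (R : realType) (Z : normedModType R).

Definition dual_pred : {pred Z -> R^o} :=
  mem [set f : Z -> R^o | linear f /\ continuous f].

(* The topological dual, later equipped with the operator norm. *)
Record dual := Dual { dual_fun :> Z -> R^o; dual_funP : dual_fun \in dual_pred }.

HB.instance Definition _ := [isSub for dual_fun].
HB.instance Definition _ := [Choice of dual by <:].

Lemma dual_pred_submod : submod_closed dual_pred.
Proof.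
split=> [|a f g /set_mem[lf cf] /set_mem[lg cg]]; apply/mem_set; split.
- by move=> a x y; rewrite /GRing.zero/= scaler0 addr0.
- exact: cst_continuous.
- move=> b x y; rewrite !fctE lf lg !scalerDr !scalerA (mulrC a).
  by rewrite addrACA.
- by move=> x; apply: cvgD; [apply: cvgZr; exact: cf|exact: cg].
Qed.

HB.instance Definition _ :=
  GRing.isSubmodClosed.Build R (Z -> R^o) dual_pred dual_pred_submod.
HB.instance Definition _ := [SubChoice_isSubLmodule of dual by <:].

Lemma dual_linear (f : dual) : linear f.
Proof. by case: f => f /= /set_mem[]. Qed.

Lemma dual_continuous (f : dual) : continuous f.
Proof. by case: f => f /= /set_mem[]. Qed.

HB.instance Definition _ (f : dual) :=
  GRing.isLinear.Build R Z R^o *:%R f (dual_linear f).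

Implicit Types (f g : dual) (z : Z).

Definition dual_norm f : R :=
  sup [set `|f z| | z in [set z : Z | `|z| <= 1]].

Lemma dual_norm_has_sup (f : dual) :
  has_sup [set `|f z| | z in [set z : Z | `|z| <= 1]].
Proof.
split; first by exists `|f 0|, 0 => //=; rewrite normr0 ler01.
have /linear_bounded_continuous/bounded_funP/(_ 1)[M fM] :=
  @dual_continuous f.
by exists M => _ [z z1 <-]; exact: fM.
Qed.

Lemma dual_norm_ub f z : `|z| <= 1 -> `|f z| <= dual_norm f.
Proof.
move=> z1; apply: ub_le_sup; first by case: (dual_norm_has_sup f).
by exists z.
Qed.

Lemma dual_norm_ge0 f : 0 <= dual_norm f.
Proof.
by apply: (le_trans (normr_ge0 (f 0))); rewrite dual_norm_ub// normr0 ler01.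
Qed.

Lemma dual_normP f z : `|f z| <= dual_norm f * `|z|.
Proof.
have [->|z0] := eqVneq z 0; first by rewrite linear0 !normr0 mulr0.
have nz : 0 < `|z| by rewrite normr_gt0.
rewrite -ler_pdivrMr//.
have : `| `|z|^-1 *: z| <= 1.
  by rewrite normrZ normfV normr_id mulVf// gt_eqF.
by move/(dual_norm_ub f); rewrite linearZ/= normrZ normfV normr_id mulrC.
Qed.

Lemma dual_norm_le f (c : R) :
  (forall z, `|z| <= 1 -> `|f z| <= c) -> dual_norm f <= c.
Proof.
move=> fc; apply: ge_sup; first by case: (dual_norm_has_sup f).
by move=> _ [z z1 <-]; exact: fc.
Qed.

Lemma dual_normD f g : dual_norm (f + g) <= dual_norm f + dual_norm g.
Proof.
apply: dual_norm_le => z z1; apply: (le_trans (ler_normD _ _)).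
by apply: lerD; exact: dual_norm_ub.
Qed.

Lemma dual_normZ (l : R) f : dual_norm (l *: f) = `|l| * dual_norm f.
Proof.
have le (k : R) g : dual_norm (k *: g) <= `|k| * dual_norm g.
  apply: dual_norm_le => z z1; rewrite normrM ler_wpM2l//.
  exact: dual_norm_ub.
apply/eqP; rewrite eq_le le/=.
have [->|l0] := eqVneq l 0; first by rewrite normr0 mul0r dual_norm_ge0.
rewrite -ler_pdivlMl ?normr_gt0//.
by have := le l^-1 (l *: f); rewrite scalerK// normfV.
Qed.

Lemma dual_norm_eq0 f : dual_norm f = 0 -> f = 0.
Proof.
move=> f0; apply/val_inj/funext => z /=; apply/eqP.
by rewrite -normr_le0 (le_trans (dual_normP f z))// f0 mul0r.
Qed.

HB.instance Definition _ :=
  Lmodule_isNormed.Build R dual dual_normD dual_normZ dual_norm_eq0.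

End dual_space.

Section dual_pair.
Context (R : realType) (X Y : normedModType R).

Lemma dual_pair_subproof (xs : dual X) (ys : dual Y) :
  (fun p : X * Y => xs p.1 + ys p.2) \in @dual_pred R (X * Y)%type.
Proof.
apply/mem_set; split=> [a p q /=|p].
  by rewrite !linearP/= scalerDr addrACA.
apply: cvgD.
  by apply: continuous_comp; [exact: cvg_fst|exact: dual_continuous].
by apply: continuous_comp; [exact: cvg_snd|exact: dual_continuous].
Qed.

(* Identifies the dual of X * Y with the product of the duals. *)
Definition dual_pair (xs : dual X) (ys : dual Y) : dual (X * Y)%type :=
  Dual (dual_pair_subproof xs ys).

End dual_pair.

Section linear_subspace.
Context (R : realType) (X : normedModType R) (U : submodClosed X).

(* The linear subspace U as a normed space of its own, with the norm of X;
   classically every linear subspace is a submodClosed predicate. *)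
Record linsub := Linsub { linsub_val : X; linsub_valP : linsub_val \in U }.

HB.instance Definition _ := [isSub for linsub_val].
HB.instance Definition _ := [Choice of linsub by <:].
HB.instance Definition _ := [SubChoice_isSubLmodule of linsub by <:].

Definition linsub_norm (u : linsub) : R := `|val u|.

Lemma linsub_normD u v : linsub_norm (u + v) <= linsub_norm u + linsub_norm v.
Proof. exact: ler_normD. Qed.

Lemma linsub_normZ (l : R) u : linsub_norm (l *: u) = `|l| * linsub_norm u.
Proof. exact: normrZ. Qed.

Lemma linsub_norm_eq0 u : linsub_norm u = 0 -> u = 0.
Proof. by move=> /normr0_eq0 u0; apply/val_inj. Qed.

HB.instance Definition _ :=
  Lmodule_isNormed.Build R linsub linsub_normD linsub_normZ linsub_norm_eq0.

End linear_subspace.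

Definition separable (T : topologicalType) :=
  exists2 D : set T, countable D & dense D.

(* The subspaces need not be closed: a subspace and its closure have the same
   dual, so this quantifies over no more duals than closed subspaces do. *)
Definition asplund (R : realType) (X : completeNormedModType R) :=
  forall U : submodClosed X, separable (linsub U) -> separable (dual (linsub U)).

Section sets.
Context (R : realType) (Z : normedModType R).
Implicit Types (S A B : set Z) (z : Z).

(* Unlike the library's ball, this allows the radius +oo. *)
Definition oball z (r : \bar R) : set Z := [set u | (`|u - z|%:E < r)%E].

Definition set_dist z S : \bar R := ereal_inf [set `|u - z|%:E | u in S].

Definition set_add A B : set Z := [set a + b | a in A & b in B].

End sets.

Section normal_cones.
Context (R : realType) (Z : normedModType R).
Implicit Types (S : set Z) (z : Z).

(* The filter below contains the empty set when z is isolated in S, and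
   limf_esup is then -oo, so that every functional is normal. *)
Definition frechet_normal S z : set (dual Z) := [set zs | S z /\
  (limf_esup (fun u => (zs (u - z) / `|u - z|)%:E)
     (within (S `\ z) (nbhs z)) <= 0)%E].

(* t_k decreasing to 0 is read as t_k > 0 with limit 0; requiring monotonicity
   would not change the cone, by passing to subsequences. *)
Definition clarke_tangent S z : set Z := [set w |
  forall (zk : nat -> Z) (t : nat -> R),
    (forall k, S (zk k)) -> zk @ \oo --> z ->
    (forall k, 0 < t k) -> t @ \oo --> (0 : R) ->
    exists2 wk : nat -> Z, wk @ \oo --> w & forall k, S (zk k + t k *: wk k)].

Definition clarke_normal S z : set (dual Z) := [set zs | S z /\
  forall w, clarke_tangent S z w -> zs w <= 0].

End normal_cones.

Section mappings.
Context (R : realType) (X Y : normedModType R) (F : X -> set Y).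

Definition gph : set (X * Y) := [set p | F p.1 p.2].

Definition image_set (A : set X) : set Y := \bigcup_(x in A) F x.

End mappings.

Definition normal_cone (R : realType) :=
  forall Z : normedModType R, set Z -> Z -> set (dual Z).

Section coderivative.
Context (R : realType) (N : normal_cone R) (X Y : normedModType R).
Implicit Types (F : X -> set Y) (Omega : set X).

(* Empty off the graph, since N is empty there for both normal cones. *)
Definition coderivative F x y (ys : dual Y) : set (dual X) :=
  [set xs | N (gph F) (x, y) (dual_pair xs (- ys))].

Definition QC F Omega xbar ybar := exists2 eps : R, 0 < eps &
  forall x1 y1 x2 (x1s x2s : dual X),
    (gph F `&` ball (xbar, ybar) eps) (x1, y1) ->
    (Omega `&` ball xbar eps) x2 ->
    (\bigcup_(ys in ball (0 : dual Y) eps) coderivative F x1 y1 ys) x1s ->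
    N Omega x2 x2s ->
    `|x1s| + `|x2s| = 1 ->
    eps <= `|x1s + x2s|.

End coderivative.

Section level_sets.
Context (R : realType) (Y : normedModType R) (L : Y -> set Y).

Definition Lcirc y : set Y := L y `\ y.

Definition Lminus y : set Y := L y `|` [set y].

Definition O1 ybar := limf_einf (fun y => set_dist ybar (L y))
  (within (Lcirc ybar) (nbhs ybar)) = 0%E.

Definition O5 ybar := forall y v,
  Lcirc ybar y -> closure (L y) v -> Lcirc ybar v.

Definition extremal (X : normedModType R) (F : X -> set Y) (Omega : set X)
    xbar ybar :=
  exists2 rho : \bar R, (0 < rho)%E &
    image_set F (Omega `&` oball xbar rho) `&` Lcirc ybar
      `&` oball ybar rho = set0.

End level_sets.

(* Main.v *)
Require Import Defs.
From HB Require Import structures.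
From mathcomp Require Import all_boot all_order all_algebra.
From mathcomp Require Import all_classical all_reals all_analysis.
From mathcomp Require Import ring lra.
Import Order.TTheory GRing.Theory Num.Theory.
Import numFieldNormedType.Exports.
Local Open Scope classical_set_scope.
Local Open Scope ring_scope.

(** Condition (O1) gives [y] near [ybar] with [cl (L y)] close to [ybar], and by
    (O5) and extremality the closed sets [gph F] and [Omega x cl (L y)] of
    [X * Y] do not meet near [(xbar, ybar)], although their gap is arbitrarily
    small there. The extremal principle then yields normals to the two sets at
    nearby points which almost cancel and are bounded away from 0; the
    qualification condition keeps their [Y]-component away from 0, and dividing
    by its norm gives the multipliers.

    The extremal principle is obtained by minimising the gap over the product
    of the two sets, up to a small perturbation. For Clarke normals any convex
    perturbation will do, by the Hahn-Banach theorem. For Frechet normals in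
    Asplund spaces:
    - if the dual is separable for the norm of uniform convergence on the ball
      of a separable subspace [U], with a dense sequence [f_n], every continuous
      sublinear [tau] is the uniform limit of the conjugates
      [x |-> sup { f x - s * q f | f <= tau }] of
      [q f = sum_n 2^-n |f - f_n|^2] as [s] tends to 0. These are Frechet
      differentiable along [U], because almost maximisers [g] of [f x - s * q f]
      have [|g - f_n|] close to [|f - f_n|] for every [n], [f] being the
      maximiser, and this forces [g] to be close to [f] in norm. So there is a
      smooth variational principle on [U];
    - [U] can be chosen so large that normals to the trace on [U] of a set lift
      to normals to the set: by Hahn-Banach the existence of the latter amounts
      to inequalities between finitely many points of the set, and [U] is the
      closure of a countable set that contains witnesses for their failure. *)

Set Implicit Arguments.
Unset Strict Implicit.
Unset Printing Implicit Defensive.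

(** * The Hahn-Banach theorem for sublinear functions *)

Section hahn_banach.
Context (R : realType).

(** Positive homogeneity is asked as an inequality only; using it for [c^-1] as well gives equality,
    and the factors 2 and 1/2 force the value 0 at the origin. *)
Definition sublinear (V : lmodType R) (p : V -> R) :=
  (forall x y, p (x + y) <= p x + p y) /\
  (forall c x, 0 < c -> p (c *: x) <= c * p x).

Lemma sublinear0 (V : lmodType R) (p : V -> R) : sublinear p -> p 0 = 0.
Proof.
move=> [_ ps]; have h2 : (0 : R) < 2 by lra.
have h1 : (0 : R) < 2^-1 by lra.
have := ps 2 0 h2; have := ps 2^-1 0 h1; rewrite !scaler0; lra.
Qed.

Lemma sublinearZ (V : lmodType R) (p : V -> R) c x :
  sublinear p -> 0 <= c -> p (c *: x) = c * p x.
Proof.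
move=> ps; rewrite le_eqVlt => /predU1P[<-|c0].
  by rewrite scale0r mul0r sublinear0.
apply/eqP; rewrite eq_le ps.2//=.
have ci0 : 0 < c^-1 by rewrite invr_gt0.
have := ps.2 c^-1 (c *: x) ci0.
by rewrite scalerA mulVf ?gt_eqF// scale1r ler_pdivlMl.
Qed.

Lemma sublinear_ge (V : lmodType R) (p : V -> R) x :
  sublinear p -> - p (- x) <= p x.
Proof.
by move=> ps; have := ps.1 x (- x); rewrite subrr sublinear0//; lra.
Qed.

(** Lower bounds of chains for Zorn's lemma. In the pointwise infimum, almost minimisers at [x] and
    at [y] are members of a chain, so the smaller one serves both points and subadditivity
    survives. *)
Lemma sublinear_le_inf (V : lmodType R) (p : V -> R) (A : set (V -> R)) :
  A !=set0 -> (forall q, A q -> sublinear q /\ forall x, q x <= p x) ->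
  total_on A (fun q r => forall x, r x <= q x) ->
  exists q0, [/\ sublinear q0, forall x, q0 x <= p x &
                forall q, A q -> forall x, q0 x <= q x].
Proof.
move=> [a Aa] Ap At.
pose I x := [set q x | q in A].
have Ilb x : has_lbound (I x).
  exists (- p (- x)) => _ [q Aq <-]; have [qs qp] := Ap q Aq.
  by apply: (le_trans _ (sublinear_ge x qs)); rewrite lerN2.
have I0 x : I x !=set0 by exists (a x), a.
have Ii x : has_inf (I x) by split.
have le q x : A q -> inf (I x) <= q x.
  by move=> Aq; apply: ge_inf => //; exists q.
exists (fun x => inf (I x)); split => [|x|q Aq x]; last exact: le.
- split=> [x y|c x c0].
    apply/ler_addgt0Pr => e e0.
    have e20 : 0 < e / 2 by rewrite divr_gt0.
    have [_ [q Aq <-] qx] := inf_adherent e20 (Ii x).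
    have [_ [r Ar <-] ry] := inf_adherent e20 (Ii y).
    have [qr|rq] := At _ _ Aq Ar.
      have := le r (x + y) Ar; have := (Ap r Ar).1.1 x y.
      by have := qr x; lra.
    have := le q (x + y) Aq; have := (Ap q Aq).1.1 x y.
    by have := rq y; lra.
  rewrite -ler_pdivrMl//; apply: lb_le_inf => // _ [q Aq <-].
  rewrite ler_pdivrMl//; apply: le_trans (le q _ Aq) _.
  exact: (Ap q Aq).1.2.
- by apply: le_trans (le a x Aa) _; exact: (Ap a Aa).2.
Qed.

(* Minimal sublinear functions are linear, and Zorn's lemma provides one. *)
Lemma hahn_banach (V : lmodType R) (p : V -> R) : sublinear p ->
  exists f : V -> R^o, linear f /\ forall x, f x <= p x.
Proof.
move=> ps.
pose T := {q : V -> R | sublinear q /\ forall x, q x <= p x}.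
pose le (q r : T) := `[< forall x, sval r x <= sval q x >].
have [||q r /asboolP qr /asboolP rq|A At|[q [qs qp]] qmin] := @Zorn T le.
- by move=> q; apply/asboolP.
- move=> q r s /asboolP qr /asboolP rs; apply/asboolP => x.
  exact: le_trans (rs x) (qr x).
- case: q r qr rq => [q qP] [r rP] /= qr rq.
  have qrE : q = r by apply/funext => x; apply/eqP; rewrite eq_le qr rq.
  by subst r; congr exist; exact: Prop_irrelevance.
- have [->|/set0P[a Aa]] := eqVneq A set0.
    by exists (exist _ p (conj ps (fun x => lexx _))).
  have [||_ _ [q1 Aq1 <-] [q2 Aq2 <-]|q0 [q0s q0p q0A]] :=
    @sublinear_le_inf V p [set sval q | q in A].
  + by exists (sval a), a.
  + by move=> _ [q Aq <-]; exact: (svalP q).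
  + by have [/asboolP|/asboolP] := At _ _ Aq1 Aq2; [left|right].
  + exists (exist _ q0 (conj q0s q0p)) => q Aq; apply/asboolP => x.
    by apply: q0A; exists q.
have qadd x y : q x + q y <= q (x + y).
  (* The infimum of these values is sublinear in [z] and lies below [q], so minimality makes it
     equal to [q]; then [t = 1] gives superadditivity. *)
  pose I z := [set q (z + t *: y) - t * q y | t in [set t : R | 0 <= t]].
  have lb z t : 0 <= t -> - q (- z) <= q (z + t *: y) - t * q y.
    move=> t0; have := qs.1 (z + t *: y) (- z).
    by rewrite addrAC subrr add0r sublinearZ//; lra.
  have Ii z : has_inf (I z).
    split; first by exists (q (z + 0 *: y) - 0 * q y), 0 => //=.
    by exists (- q (- z)) => _ [t t0 <-]; exact: lb.
  have Ile z t : 0 <= t -> inf (I z) <= q (z + t *: y) - t * q y.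
    by move=> t0; apply: ge_inf; [case: (Ii z)|exists t].
  pose q' z := inf (I z).
  have q'q z : q' z <= q z.
    by have := Ile z 0 (lexx _); rewrite scale0r mul0r addr0 subr0.
  have q's : sublinear q'.
    split=> [z w|c z c0].
      apply/ler_addgt0Pr => e e0.
      have e20 : 0 < e / 2 by rewrite divr_gt0.
      have [_ [t /= t0 <-] tz] := inf_adherent e20 (Ii z).
      have [_ [s /= s0 <-] sw] := inf_adherent e20 (Ii w).
      have := Ile (z + w) (t + s) (addr_ge0 t0 s0).
      have := qs.1 (z + t *: y) (w + s *: y).
      rewrite addrACA -scalerDl /q'; lra.
    rewrite -ler_pdivrMl//; apply: lb_le_inf; first exact: (Ii z).1.
    move=> _ [t /= t0 <-]; rewrite ler_pdivrMl//.
    have ct0 : 0 <= c * t by rewrite mulr_ge0// ltW.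
    apply: le_trans (Ile _ _ ct0) _.
    by rewrite -scalerA -scalerDr (sublinearZ _ qs (ltW c0)) -mulrA -mulrBr.
  have q'p z : q' z <= p z by exact: le_trans (q'q z) (qp z).
  have /(congr1 sval)/= q'E := qmin (exist _ q' (conj q's q'p)) (asboolT q'q).
  have := Ile x 1 ler01.
  by rewrite -/(q' x) q'E scale1r mul1r; lra.
have qD x y : q (x + y) = q x + q y.
  by apply/eqP; rewrite eq_le qs.1 qadd.
have qN x : q (- x) = - q x.
  by apply/eqP; rewrite -addr_eq0 -qD addrC subrr sublinear0.
exists q; split=> // c x y; rewrite qD; congr (_ + _).
have [c0|/ltW c0] := leP 0 c; first exact: sublinearZ.
rewrite -[c]opprK scaleNr qN sublinearZ ?oppr_ge0//.
by rewrite scaleNr.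
Qed.

End hahn_banach.

(** * Functionals below a sublinear function: separation and weak-star compactness *)

Section dual_lemmas.
Context (R : realType) (Z : normedModType R).
Implicit Types (f g : dual Z) (tau : Z -> R).

Lemma mk_dual (f : Z -> R^o) (K : R) : linear f ->
  (forall x, f x <= K * `|x|) -> exists g : dual Z, forall x, g x = f x.
Proof.
move=> fl fK.
pose lf := GRing.isLinear.Build R Z R^o *:%R f fl.
pose F : {linear Z -> R^o} := HB.pack f lf.
have fc : continuous f.
  apply/(@linear_bounded_continuous R Z R^o F)/bounded_funP => r.
  exists (`|K| * `|r|) => x xr.
  have Kx y : `|y| = `|x| -> f y <= `|K| * `|r|.
    move=> yx; apply: le_trans (fK y) _; rewrite yx.
    apply: (le_trans (ler_wpM2r (normr_ge0 x) (ler_norm K))).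
    by rewrite ler_wpM2l// (le_trans xr)// ler_norm.
  rewrite ler_norml Kx// andbT lerNl.
  by rewrite -[X in X <= _](raddfN F) Kx// normrN.
have fP : f \in @dual_pred R Z by apply/mem_set.
by exists (Dual fP).
Qed.

Lemma dual_hahn_banach tau (K : R) : sublinear tau ->
  (forall x, tau x <= K * `|x|) -> exists g : dual Z, forall x, g x <= tau x.
Proof.
move=> ts tK; have [f [fl fle]] := hahn_banach ts.
have [|g gE] := @mk_dual f K fl; first by move=> x; exact: le_trans (fle x) _.
by exists g => x; rewrite gE.
Qed.

(* A common generalisation of the Hahn-Banach sandwich theorem and of Farkas'
   lemma: G is a convex cone of constraints "g v <= r". *)
Lemma sandwich tau (K : R) (G : Z -> R -> Prop) : sublinear tau ->
  (forall x, tau x <= K * `|x|) ->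
  G 0 0 -> (forall v r w s, G v r -> G w s -> G (v + w) (r + s)) ->
  (forall c v r, 0 < c -> G v r -> G (c *: v) (c * r)) ->
  (forall v r, G v r -> 0 <= r + tau (- v)) ->
  exists g : dual Z, (forall x, g x <= tau x) /\ forall v r, G v r -> g v <= r.
Proof.
move=> ts tK G0 GD GZ Gge.
(* The infimal convolution of [tau] with the constraints: a functional below it is below [tau] and
   satisfies every constraint. The compatibility hypothesis keeps it finite. *)
pose I u := [set x | exists v r, G v r /\ x = r + tau (u - v)].
have Ilb u v r : G v r -> - tau (- u) <= r + tau (u - v).
  move=> /Gge vr; have := ts.1 (u - v) (- u).
  by rewrite addrAC subrr add0r; lra.
have Ii u : has_inf (I u).
  split; first by exists (0 + tau (u - 0)), 0, 0.
  by exists (- tau (- u)) => _ [v [r [Gvr ->]]]; exact: Ilb.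
pose p u := inf (I u).
have pI u v r : G v r -> p u <= r + tau (u - v).
  by move=> Gvr; apply: ge_inf; [case: (Ii u)|exists v, r].
have ps : sublinear p.
  split=> [x y|c x c0].
    apply/ler_addgt0Pr => e e0.
    have e20 : 0 < e / 2 by rewrite divr_gt0.
    have [_ [v [r [vr ->]]] vrx] := inf_adherent e20 (Ii x).
    have [_ [w [s [ws ->]]] wsy] := inf_adherent e20 (Ii y).
    have := pI (x + y) _ _ (GD _ _ _ _ vr ws).
    have := ts.1 (x - v) (y - w).
    rewrite addrACA -opprD /p; lra.
  rewrite -ler_pdivrMl//; apply: lb_le_inf; first by case: (Ii x).
  move=> _ [v [r [vr ->]]]; rewrite ler_pdivrMl//.
  apply: le_trans (pI _ _ _ (GZ c _ _ c0 vr)) _.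
  by rewrite -scalerBr (sublinearZ _ ts (ltW c0)) mulrDr.
have ple x : p x <= tau x.
  by have := pI x _ _ G0; rewrite subr0 add0r.
have [|g gp] := @dual_hahn_banach p K ps.
  by move=> x; exact: le_trans (ple x) _.
exists g; split=> [x|v r vr]; first exact: le_trans (gp x) _.
apply: le_trans (gp v) _; have := pI v _ _ vr.
by rewrite subrr sublinear0// addr0.
Qed.

Lemma sublinear_support tau (K : R) x : sublinear tau ->
  (forall x, tau x <= K * `|x|) ->
  exists g : dual Z, (forall v, g v <= tau v) /\ g x = tau x.
Proof.
move=> ts tK.
have [|||v r [c [c0 -> ->]]|g [gt gG]] := @sandwich tau K
  (fun v r => exists c, [/\ 0 <= c, v = - (c *: x) & r = - (c * tau x)]) ts tK.
- by exists 0; rewrite scale0r mul0r !oppr0.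
- move=> _ _ _ _ [c [c0 -> ->]] [d [d0 -> ->]].
  exists (c + d); split; first exact: addr_ge0.
    by rewrite scalerDl opprD.
  by rewrite mulrDl opprD.
- move=> d _ _ d0 [c [c0 -> ->]].
  exists (d * c); split; first by rewrite mulr_ge0// ltW.
    by rewrite scalerN scalerA.
  by rewrite mulrN mulrA.
- by rewrite opprK (sublinearZ _ ts c0) addNr.
exists g; split=> //; apply/eqP; rewrite eq_le gt/=.
have := gG (- (1 *: x)) (- (1 * tau x)).
rewrite scale1r mul1r raddfN/= lerN2; apply.
by exists 1; rewrite scale1r mul1r.
Qed.

End dual_lemmas.

Section dual_eval.
Context (R : realType) (Z : normedModType R).
Implicit Types (f g : dual Z) (tau : Z -> R).

Lemma dualD f g u : (f + g) u = f u + g u. Proof. by []. Qed.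
Lemma dualZ a f u : (a *: f) u = a * f u. Proof. by []. Qed.
Lemma dualN f u : (- f) u = - f u.
Proof. by rewrite -scaleN1r dualZ mulN1r. Qed.
Lemma dual0 u : (0 : dual Z) u = 0.
Proof. by rewrite -(scale0r (0 : dual Z)) dualZ mul0r. Qed.

Lemma dual_evalP f a u v : f (a *: u + v) = a * f u + f v :> R.
Proof. exact: dual_linear. Qed.
Lemma dual_evalD f u v : f (u + v) = f u + f v :> R.
Proof. by rewrite -[u]scale1r dual_evalP mul1r scale1r. Qed.
Lemma dual_eval0 f : f 0 = 0 :> R. Proof. exact: raddf0. Qed.
Lemma dual_evalZ f a u : f (a *: u) = a * f u :> R.
Proof. by rewrite -[a *: u]addr0 dual_evalP dual_eval0 addr0. Qed.
Lemma dual_evalN f u : f (- u) = - f u :> R. Proof. exact: raddfN. Qed.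
Lemma dual_evalB f u v : f (u - v) = f u - f v :> R.
Proof. by rewrite dual_evalD dual_evalN. Qed.

Lemma dual_le_abs tau K f v : (forall x, tau x <= K * `|x|) ->
  (forall x, f x <= tau x) -> `|f v| <= K * `|v|.
Proof.
move=> tK ft; rewrite ler_norml (le_trans (ft v) (tK v)) andbT lerNl.
rewrite -dual_evalN.
by rewrite (le_trans (ft _))// (le_trans (tK _))// normrN.
Qed.

(* Alaoglu's theorem for the set of functionals below tau. *)
Lemma dual_cluster tau (K : R) (F : set_system (dual Z)) :
  ProperFilter F -> (forall x, tau x <= K * `|x|) ->
  F [set f : dual Z | forall v, f v <= tau v] ->
  exists (g : dual Z) (G : set_system (dual Z)),
    [/\ ProperFilter G, F `<=` G, forall v, g v <= tau v &
        forall v (e : R), 0 < e -> G [set f : dual Z | `|f v - g v| < e]].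
Proof.
move=> FF tK Ft; have [G [GU FG]] := ultraFilterLemma FF.
have GP : ProperFilter G by exact: ultra_proper.
have GF : Filter G by typeclasses eauto.
have Gt := FG _ Ft.
(* Each evaluation stays in a compact segment, hence converges along the ultrafilter [G]. Linearity
   of the limit involves only three evaluations at a time, so it passes to the limit. *)
have lim v : exists c : R, forall e : R, 0 < e -> G [set f : dual Z | `|f v - c| < e].
  have [|c [_ cc]] := @segment_compact R (- tau (- v)) (tau v)
      ((fun f : dual Z => f v : R) @ G) (fmap_proper_filter _ GP).
    suff H : G [set f : dual Z | `[- tau (- v), tau v]%classic (f v)] by exact: H.
    apply: filterS Gt => f ft; rewrite /= in_itv/= (ft v) andbT lerNl.
    rewrite -dual_evalN; exact: ft.
  exists c => e e0.
  have [//|Gc] := in_ultra_setVsetC [set f : dual Z | `|f v - c| < e] GU.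
  have [|y] := cc [set y : R | ~ `|y - c| < e] (ball c e) _ (nbhsx_ballx c e e0).
    suff H : G [set f : dual Z | ~ `|f v - c| < e] by exact: H.
    by apply: filterS Gc => f.
  case=> n1; rewrite -ball_normE/= distrC => n2; case: (n1 n2).
have [g gP] := choice lim.
have near2 v w e : 0 < e -> exists f : dual Z,
    [/\ forall v, f v <= tau v, `|f v - g v| < e & `|f w - g w| < e].
  move=> e0; have /filter_ex := @filterI _ G GF _ _ Gt
    (@filterI _ G GF _ _ (gP v e e0) (gP w e e0)).
  by move=> [f [? [? ?]]]; exists f.
have near3 u v w e : 0 < e -> exists f : dual Z,
    [/\ `|f u - g u| < e, `|f v - g v| < e & `|f w - g w| < e].
  move=> e0; have /filter_ex := @filterI _ G GF _ _ (gP u e e0)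
    (@filterI _ G GF _ _ (gP v e e0) (gP w e e0)).
  by move=> [f [? [? ?]]]; exists f.
have gt v : g v <= tau v.
  apply/ler_addgt0Pr => e e0; have [f [ft fv _]] := near2 v v e e0.
  by have := ft v; move: fv; rewrite ltr_distl => /andP[]; lra.
have gl : linear (g : Z -> R^o).
  move=> a u v; apply/eqP; rewrite -subr_eq0 -normr_le0.
  apply/ler_addgt0Pr => e e0; rewrite add0r.
  have a0 : 0 < `|a| + 2 by apply: ltr_wpDl.
  have d0 : 0 < e / (`|a| + 2) by rewrite divr_gt0.
  have [f [fu fv fw]] := near3 u v (a *: u + v) _ d0.
  rewrite [a *: (g u : R^o)]/(a * g u).
  have -> : g (a *: u + v) - (a * g u + g v) =
      - (f (a *: u + v) - g (a *: u + v)) + a * (f u - g u) + (f v - g v).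
    by rewrite dual_evalP; ring.
  apply: le_trans (ler_normD _ _) _; apply: le_trans (lerD (ler_normD _ _) (lexx _)) _.
  rewrite normrN normrM.
  have -> : e = e / (`|a| + 2) + `|a| * (e / (`|a| + 2)) + e / (`|a| + 2).
    by field; rewrite gt_eqF.
  by rewrite lerD ?(ltW fv)// lerD ?(ltW fw)// ler_wpM2l// ltW.
have [|g' g'E] := @mk_dual R Z g K gl.
  by move=> x; exact: le_trans (gt x) (tK x).
exists g', G; split=> // [v|v e e0]; first by rewrite g'E.
by apply: filterS (gP v e e0) => f; rewrite /= g'E.
Qed.

End dual_eval.

Lemma dual_components (R : realType) (X Y : normedModType R)
    (f : dual (X * Y)%type) : exists (f1 : dual X) (f2 : dual Y),
  [/\ forall x, f1 x = f (x, 0), forall y, f2 y = f (0, y) &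
   forall p, f p = f1 p.1 + f2 p.2].
Proof.
have [||f1 f1E] := @mk_dual R X (fun x => f (x, 0)) `|f|.
- move=> a x y; rewrite -[RHS](dual_evalP f); congr (f _).
  by apply: injective_projections; rewrite /= ?scaler0 ?addr0.
- move=> x; apply: le_trans (ler_norm _) _; apply: le_trans (dual_normP f _) _.
  by rewrite prod_normE/= normr0 (max_l (normr_ge0 x)).
have [||f2 f2E] := @mk_dual R Y (fun y => f (0, y)) `|f|.
- move=> a x y; rewrite -[RHS](dual_evalP f); congr (f _).
  by apply: injective_projections; rewrite /= ?scaler0 ?addr0.
- move=> y; apply: le_trans (ler_norm _) _; apply: le_trans (dual_normP f _) _.
  by rewrite prod_normE/= normr0 (max_r (normr_ge0 y)).
exists f1, f2; split=> // -[x y]; rewrite f1E f2E -dual_evalD; congr (f _).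
by apply: injective_projections; rewrite /= ?addr0 ?add0r.
Qed.

(** * Smooth approximation of sublinear functions under separability of the dual *)

Section tame.
Context (R : realType) (Z : normedModType R).
Implicit Types (f g : dual Z) (tau : Z -> R) (D : set Z).

(* P is convex, tau-Lipschitz, and Frechet differentiable along D. *)
Definition tame D tau (P : Z -> R) := forall x, exists g : dual Z,
  [/\ forall v, g v <= tau v, forall y, P x + g (y - x) <= P y &
   forall e, 0 < e -> exists2 d, 0 < d & forall y, D (y - x) -> `|y - x| < d ->
     P y <= P x + g (y - x) + e * `|y - x|].

(* The dual is separable for the seminorm of uniform convergence on the part
   of D in the unit ball. *)
Definition sepdual D := forall e : R, 0 < e -> exists c : dual Z -> nat,
  forall f g, c f = c g -> forall u, D u -> `|f u - g u| <= e * `|u|.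

(** For each accuracy [1 / (k + 1)] and each value of the classifying map [c k], one functional
    below [tau] with this value is chosen if there is any, and [f0] otherwise; [fn] enumerates the
    choices. *)
Lemma sepdual_dense D tau : sepdual D ->
  (exists f, forall v, f v <= tau v) ->
  exists fn : nat -> dual Z, (forall n v, fn n v <= tau v) /\
    forall f e, (forall v, f v <= tau v) -> 0 < e ->
      exists n, forall u, D u -> `|f u - fn n u| <= e * `|u|.
Proof.
move=> sD [f0 f0t].
have sDk k : exists c : dual Z -> nat, forall f g, c f = c g ->
    forall u, D u -> `|f u - g u| <= k.+1%:R^-1 * `|u|.
  by apply: sD; rewrite invr_gt0.
have [c cP] := choice sDk.
pose fn n := if unpickle n is Some (k, j) then
  xget f0 [set f : dual Z | (forall v, f v <= tau v) /\ c k f = j] else f0.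
exists fn; split=> [n v|f e ft e0].
  rewrite /fn; case: unpickle => [[k j]|//].
  by case: xgetP => [f _ [+ _]|//]; exact.
have [k ke] : exists k, k.+1%:R^-1 < e.
  by have [k _ /(_ k (leqnn k))] := near_infty_natSinv_lt (PosNum e0); exists k.
exists (pickle (k, c k f)) => u Du; rewrite /fn pickleK.
case: xgetP => [g _ [gt gc]|/(_ f)]; last by case.
apply: le_trans (cP k _ _ (esym gc) u Du) _.
by rewrite ler_wpM2r// ltW.
Qed.

End tame.

Section smooth_approximation.
Context (R : realType) (Z : normedModType R).
Context (tau : Z -> R) (K : R) (D : set Z).
Hypothesis tau_sublinear : sublinear tau.
Hypothesis K_gt0 : 0 < K.
Hypothesis tau_le : forall x, tau x <= K * `|x|.
Variable fn : nat -> dual Z.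

Let B : set (dual Z) := [set f : dual Z | forall v, f v <= tau v].
Hypothesis fnB : forall n v, fn n v <= tau v.
Hypothesis fn_dense : forall (f : dual Z) e, (forall v, f v <= tau v) -> 0 < e ->
  exists n, forall u, D u -> `|f u - fn n u| <= e * `|u|.

(** The supremum [h f n] is the distance from [f] to [fn n] in the seminorm of uniform convergence
    along [D]. The point 0 keeps the set nonempty and contributes the value 0, as [0^-1 = 0]. *)
Let hset (f : dual Z) n :=
  [set `|f u - fn n u| / `|u| | u in [set u | D u \/ u = 0]].
Let h (f : dual Z) n : R := sup (hset f n).

Let absB f v : B f -> `|f v| <= K * `|v|.
Proof. by move=> Bf; apply: dual_le_abs Bf. Qed.

Let h_ub0 f n u : B f -> `|f u - fn n u| / `|u| <= 2 * K.
Proof.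
move=> Bf; have [->|u0] := eqVneq u 0.
  by rewrite normr0 invr0 mulr0 mulr_ge0// ltW.
rewrite ler_pdivrMr ?normr_gt0//.
apply: le_trans (ler_normB _ _) _; rewrite -mulrA.
by have := absB u Bf; have := absB u (fnB n); lra.
Qed.

Let h_sup f n : B f -> has_sup (hset f n).
Proof.
move=> Bf; split; first by exists (`|f 0 - fn n 0| / `|0 : Z|), 0 => //; right.
by exists (2 * K) => _ [u _ <-]; exact: h_ub0.
Qed.

Let h_ub f n u : B f -> D u -> `|f u - fn n u| / `|u| <= h f n.
Proof.
by move=> Bf Du; apply: ub_le_sup; [case: (h_sup n Bf)|exists u => //; left].
Qed.

Let h_norm f n u : B f -> D u -> `|f u - fn n u| <= h f n * `|u|.
Proof.
move=> Bf Du; have [->|u0] := eqVneq u 0.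
  by rewrite !dual_eval0 subrr !normr0 mulr0.
by rewrite -ler_pdivrMr ?normr_gt0// h_ub.
Qed.

Let h_ge0 f n : B f -> 0 <= h f n.
Proof.
move=> Bf; apply: ub_le_sup; first by case: (h_sup n Bf).
by exists 0; [right|rewrite normr0 invr0 mulr0].
Qed.

Let h_le f n c : B f -> 0 <= c ->
  (forall u, D u -> `|f u - fn n u| <= c * `|u|) -> h f n <= c.
Proof.
move=> Bf c0 fc; apply: ge_sup; first by case: (h_sup n Bf).
move=> _ [u Du <-]; have [->|u0] := eqVneq u 0.
  by rewrite normr0 invr0 mulr0.
by case: Du => [Du|/eqP]; rewrite ?(negbTE u0)// ler_pdivrMr ?normr_gt0// fc.
Qed.

Let h_le2K f n : B f -> h f n <= 2 * K.
Proof.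
move=> Bf; apply: ge_sup; first by case: (h_sup n Bf).
by move=> _ [u _ <-]; exact: h_ub0.
Qed.

Let w n : R := 2^-1 ^+ n.
Let w_gt0 n : 0 < w n. Proof. by rewrite exprn_gt0. Qed.

Let S N f := \sum_(n < N) w n * h f n ^+ 2.

Let S_le N f : B f -> S N f <= 8 * K ^+ 2.
Proof.
move=> Bf; apply: (@le_trans _ _ (4 * K ^+ 2 * (\sum_(n < N) w n))).
  rewrite mulr_sumr ler_sum// => n _; rewrite [leRHS]mulrC ler_pM2l//.
  have := h_ge0 n Bf; have := h_le2K n Bf => h2 h0.
  have -> : 4 * K ^+ 2 = (2 * K) ^+ 2 by ring.
  by rewrite ler_sqr// nnegrE mulr_ge0// ltW.
have : \sum_(n < N) w n = 2 - 2 * w N.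
  elim: N => [|N IH]; first by rewrite big_ord0 /w expr0; ring.
  by rewrite big_ord_recr/= IH /w exprS; field.
have := w_gt0 N; have : 0 < K ^+ 2 by rewrite exprn_gt0.
by move=> ? ? ->; nra.
Qed.

Let q f := sup [set S N f | N in setT].

Let q_sup f : B f -> has_sup [set S N f | N in setT].
Proof.
move=> Bf; split; first by exists (S 0 f), 0%N.
by exists (8 * K ^+ 2) => _ [N _ <-]; exact: S_le.
Qed.

Let q_ub f N : B f -> S N f <= q f.
Proof.
by move=> Bf; apply: ub_le_sup; [case: (q_sup Bf)|exists N].
Qed.

Let q_le f c : B f -> (forall N, S N f <= c) -> q f <= c.
Proof.
move=> Bf Sc; apply: ge_sup; first by case: (q_sup Bf).
by move=> _ [N _ <-].
Qed.

Let S_mono f M N : (M <= N)%N -> S M f <= S N f.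
Proof.
move=> /subnK <-; elim: (N - M)%N => [//|k IH]; rewrite addSn.
rewrite /S big_ord_recr/= (le_trans IH)// lerDl.
by rewrite mulr_ge0 ?sqr_ge0 ?ltW.
Qed.

Let q_ge0 f : B f -> 0 <= q f.
Proof. by move=> Bf; have := q_ub 0 Bf; rewrite /S big_ord0. Qed.

Let mid f g : dual Z := 2^-1 *: (f + g).

Let midE f g u : mid f g u = 2^-1 * (f u + g u).
Proof. by []. Qed.

Let midB f g : B f -> B g -> B (mid f g).
Proof.
by move=> Bf Bg v; rewrite midE; have := Bf v; have := Bg v; lra.
Qed.

Let h_mid f g n : B f -> B g -> h (mid f g) n <= 2^-1 * (h f n + h g n).
Proof.
move=> Bf Bg; apply: h_le; first exact: midB.
  by rewrite mulr_ge0// addr_ge0// h_ge0.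
move=> u Du; rewrite midE.
have -> : 2^-1 * (f u + g u) - fn n u =
  2^-1 * (f u - fn n u) + 2^-1 * (g u - fn n u) by field.
apply: le_trans (ler_normD _ _) _; rewrite !normrM ger0_norm//.
by have := h_norm n Bf Du; have := h_norm n Bg Du; lra.
Qed.

(** By the parallelogram identity every square in the series gains [(h f j - h g j) ^+ 2 / 4] at the
    midpoint; the gain of the term [n] is kept. *)
Let q_mid f g n : B f -> B g ->
  q (mid f g) <= 2^-1 * (q f + q g) - w n / 4 * (h f n - h g n) ^+ 2.
Proof.
move=> Bf Bg; have Bm := midB Bf Bg; apply: q_le => // N.
(* The partial sum is lengthened so that it contains the term [n]. *)
apply: le_trans (S_mono _ (leq_addr n.+1 N)) _.
set M := (N + n.+1)%N; have nM : (n < M)%N by rewrite /M addnS ltnS leq_addl.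
have SM : S M (mid f g) <= 2^-1 * (S M f + S M g) -
    \sum_(j < M) w j / 4 * (h f j - h g j) ^+ 2.
  rewrite /S -big_split/= mulr_sumr -sumrB ler_sum// => j _.
  have : h (mid f g) j ^+ 2 <= (2^-1 * (h f j + h g j)) ^+ 2.
    by rewrite ler_sqr ?nnegrE ?h_mid ?h_ge0// mulr_ge0// addr_ge0 ?h_ge0.
  by have := w_gt0 j; nra.
have : w n / 4 * (h f n - h g n) ^+ 2 <=
    \sum_(j < M) w j / 4 * (h f j - h g j) ^+ 2.
  rewrite (bigD1 (Ordinal nM))//= lerDl sumr_ge0// => j _.
  by rewrite mulr_ge0 ?sqr_ge0// divr_ge0// ltW.
have := q_ub M Bf; have := q_ub M Bg; lra.
Qed.

(** A supremum of evaluations is lower semicontinuous for pointwise convergence: a single [u] that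
    almost attains [h g n] bounds [h f n] from below for [f] near [g] at [u]. *)
Let h_lsc g (G : set_system (dual Z)) n e : ProperFilter G -> G B -> B g ->
  (forall v e, 0 < e -> G [set f : dual Z | `|f v - g v| < e]) -> 0 < e ->
  G [set f : dual Z | h g n - e < h f n].
Proof.
move=> GP GB Bg Gg e0; have e20 : 0 < e / 2 by rewrite divr_gt0.
have [_ [u Du <-] ue] := sup_adherent e20 (h_sup n Bg).
have [u0|u0] := eqVneq u 0.
  apply: (filterS _ GB) => f Bf /=; have := h_ge0 n Bf.
  by move: ue; rewrite u0 normr0 invr0 mulr0 -/(h g n); lra.
have un : 0 < `|u| by rewrite normr_gt0.
have {}Du : D u by case: Du => // /eqP; rewrite (negbTE u0).
have eu : 0 < e / 2 * `|u| by rewrite mulr_gt0.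
have GF : Filter G by typeclasses eauto.
apply: (filterS _ (@filterI _ G GF _ _ GB (Gg u _ eu))) => f [Bf /= fg].
apply: lt_le_trans (h_ub n Bf Du); rewrite ltr_pdivlMr//.
move: ue; rewrite -/(h g n) ltr_pdivlMr// => ue.
have : `|g u - fn n u| <= `|f u - g u| + `|f u - fn n u|.
  by rewrite [`|f u - g u|]distrC ler_distD.
lra.
Qed.

Let S_lsc g (G : set_system (dual Z)) N e : ProperFilter G -> G B -> B g ->
  (forall v e, 0 < e -> G [set f : dual Z | `|f v - g v| < e]) -> 0 < e ->
  G [set f : dual Z | S N g - e < S N f].
Proof.
move=> GP GB Bg Gg; have GF : Filter G by typeclasses eauto.
elim: N e => [|N IH] e e0.
  apply: (filterS _ GB) => f _; rewrite /= /S !big_ord0; lra.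
have e20 : 0 < e / 2 by rewrite divr_gt0.
(* Since [h <= 2 * K], an error [e / (8 * K)] in [h] changes its square by at most [e / 2]. *)
have d0 : 0 < e / (8 * K) by rewrite divr_gt0// mulr_gt0.
have := h_lsc N GP GB Bg Gg d0.
move=> /(@filterI _ G GF _ _ (IH _ e20))/(@filterI _ G GF _ _ GB).
apply: filterS => f [Bf [/= Sf hf]].
rewrite /S !big_ord_recr/= -!/(S _ _).
suff : w N * h g N ^+ 2 - e / 2 <= w N * h f N ^+ 2 by lra.
have w1 : w N <= 1 by rewrite exprn_ile1// invf_le1//; lra.
have [hgf|hfg] := leP (h g N) (h f N).
  have : h g N ^+ 2 <= h f N ^+ 2 by rewrite ler_sqr ?nnegrE ?h_ge0.
  by have := w_gt0 N; nra.
have hg0 := h_ge0 N Bg; have hf0 := h_ge0 N Bf.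
have hgK := h_le2K N Bg; have hfK := h_le2K N Bf.
have : h g N ^+ 2 - h f N ^+ 2 <= e / (8 * K) * (4 * K).
  rewrite subr_sqr ler_pM//; lra.
have -> : e / (8 * K) * (4 * K) = e / 2 by field; rewrite gt_eqF.
have wN := w_gt0 N.
move: (h g N ^+ 2) (h f N ^+ 2) => a b ab; nra.
Qed.

Variable s : R.
Hypothesis s_gt0 : 0 < s.

Let B_nonempty : exists f, B f. Proof. by exists (fn 0); exact: fnB. Qed.

Let valset x := [set f x - s * q f | f in B].
Let P x := sup (valset x).

Let P_sup x : has_sup (valset x).
Proof.
split; first by have [f Bf] := B_nonempty; exists (f x - s * q f), f.
exists (tau x) => _ [f Bf <-]; have := Bf x.
by have := mulr_ge0 (ltW s_gt0) (q_ge0 Bf); lra.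
Qed.

Let P_ub f x : B f -> f x - s * q f <= P x.
Proof.
by move=> Bf; apply: ub_le_sup; [case: (P_sup x)|exists f].
Qed.

(** The almost maximisers generate a filter. A weak-star cluster point of it is a maximiser, because
    the partial sums [S N] are lower semicontinuous and [q] is their supremum. *)
Let P_max x : exists2 f, B f & f x - s * q f = P x.
Proof.
pose F := filter_from [set e : R | 0 < e]
  (fun e => [set f : dual Z | B f /\ P x - e < f x - s * q f]).
have FP : ProperFilter F.
  apply: filter_from_proper; last first.
    move=> e /= e0; have [_ [f Bf <-] fe] := sup_adherent e0 (P_sup x).
    by exists f.
  apply: filter_from_filter; first by exists 1 => /=.
  move=> a b /= a0 b0; exists (Num.min a b); first by rewrite /= lt_min a0.
  by move=> f [Bf]; have := ge_min a a b; have := ge_min b a b;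
    rewrite !lexx ?orbT/= => ? ?; split; split => //; lra.
have FB : F B by exists 1 => //= f [].
have [g [G [GP FG Bg Gg]]] := dual_cluster FP tau_le FB.
have GF : Filter G by typeclasses eauto.
exists g => //; apply/eqP; rewrite eq_le P_ub//=.
suff qg : q g <= (g x - P x) / s by move: qg; rewrite ler_pdivlMr//; lra.
apply: q_le => // N; rewrite ler_pdivlMr//.
apply/ler_addgt0Pr => e e0.
have d0 : 0 < e / (s + 2) by rewrite divr_gt0// addr_gt0.
have := S_lsc N GP (FG _ FB) Bg Gg d0.
move=> /(@filterI _ G GF _ _ (Gg x _ d0)).
have : G [set f : dual Z | B f /\ P x - e / (s + 2) < f x - s * q f].
  by apply: FG; exists (e / (s + 2)).
move=> /(@filterI _ G GF _ _) H/H/filter_ex[f [[Bf fP] [/= fx SN]]].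
have {SN} : s * S N g <= s * (q f + e / (s + 2)).
  by rewrite ler_pM2l//; have := q_ub N Bf; lra.
have eE : e / (s + 2) * (s + 2) = e by rewrite divfK// gt_eqF// addr_gt0.
move: fx; rewrite ltr_distl => /andP[_].
by move: eE fP; rewrite mulrDr [_ * s]mulrC; lra.
Qed.

(** The derivative at [x] is the maximiser [f] there. The maximiser [g] at a nearby [y] almost
    maximises at [x], so testing [mid f g] makes [h g n] close to [h f n], which is small for a
    suitable [n]. Thus [g] is close to [f] along [D], and [P y <= P x + g (y - x)] yields the upper
    estimate. *)
Let P_tame : tame D tau P.
Proof.
move=> x; have [f Bf fx] := P_max x; exists f; split => // [y|e e0].
  by apply: le_trans (P_ub y Bf); rewrite dual_evalB -fx; lra.
have e50 : 0 < e / 5 by rewrite divr_gt0.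
have [n nf] := fn_dense Bf e50.
have hf : h f n <= e / 5 by apply: h_le => //; exact: ltW.
have wn := w_gt0 n.
(* The midpoint gain [s * (w n / 4) * (h f n - h g n) ^+ 2] is at most [K * |y - x|]; within this
   radius it forces [|h f n - h g n| < e / 5]. *)
exists (s * (w n / 4) * (e / 5) ^+ 2 / K).
  by rewrite divr_gt0// mulr_gt0 ?exprn_gt0// mulr_gt0// divr_gt0.
move=> y Dy; rewrite ltr_pdivlMr// => yx.
have [g Bg gy] := P_max y.
have Pf : P x + f (y - x) <= P y.
  by apply: le_trans (P_ub y Bf); rewrite dual_evalB -fx; lra.
have Pg : P y - g (y - x) <= P x.
  by apply: le_trans (P_ub x Bg); rewrite dual_evalB -gy; lra.
have Pm := P_ub x (midB Bf Bg).
have qm : s * q (mid f g) <=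
    s * (2^-1 * (q f + q g) - w n / 4 * (h f n - h g n) ^+ 2).
  by rewrite ler_pM2l//; exact: q_mid.
have absfg : `|g (y - x)| + `|f (y - x)| <= 2 * (K * `|y - x|).
  by have := absB (y - x) Bf; have := absB (y - x) Bg; lra.
have gle := ler_norm (g (y - x)); have fle := ler_norm (- f (y - x)).
rewrite normrN in fle.
have sq : s * (w n / 4) * (h f n - h g n) ^+ 2 < s * (w n / 4) * (e / 5) ^+ 2.
  apply: le_lt_trans yx; move: Pm qm; rewrite midE.
  move: Pf Pg gy fx absfg gle fle; rewrite !dual_evalB; lra.
have {sq} hfg : `|h f n - h g n| < e / 5.
  move: sq; rewrite ltr_pM2l ?mulr_gt0 ?divr_gt0//.
  by rewrite -real_normK ?num_real// ltr_sqr ?nnegrE// ltW.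
have hg : h g n <= 2 * (e / 5).
  by move: hfg; rewrite ltr_distl => /andP[+ _]; lra.
have := h_norm n Bf Dy; have := h_norm n Bg Dy.
have hfy := ler_wpM2r (normr_ge0 (y - x)) hf.
have hgy := ler_wpM2r (normr_ge0 (y - x)) hg.
have := ler_norm (g (y - x) - fn n (y - x)).
have := ler_norm (- (f (y - x) - fn n (y - x))); rewrite normrN.
have : 0 <= e * `|y - x| by rewrite mulr_ge0// ltW.
move: hfy hgy; rewrite -!mulrA; lra.
Qed.

Lemma smooth_approx_aux : exists P0 : Z -> R, tame D tau P0 /\
  forall x, tau x - s * (8 * K ^+ 2) <= P0 x <= tau x.
Proof.
exists P; split=> // x; apply/andP; split.
  have [f [Bf fx]] := sublinear_support x tau_sublinear tau_le.
  apply: le_trans (P_ub x Bf); rewrite fx lerB// ler_pM2l//.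
  by apply: q_le => // N; exact: S_le.
apply: ge_sup; first by case: (P_sup x).
move=> _ [f Bf <-]; have := Bf x.
by have := mulr_ge0 (ltW s_gt0) (q_ge0 Bf); lra.
Qed.

End smooth_approximation.

Lemma smooth_approx (R : realType) (Z : normedModType R) (tau : Z -> R) (K : R)
    (D : set Z) (sigma : R) :
  sublinear tau -> (forall x, tau x <= K * `|x|) -> sepdual D -> 0 < sigma ->
  exists P, tame D tau P /\ forall x, tau x <= P x <= tau x + sigma.
Proof.
move=> ts tK sD s0; pose K' := `|K| + 1.
have K0 : 0 < K' by rewrite ltr_wpDl.
have tK' x : tau x <= K' * `|x|.
  apply: le_trans (tK x) _; rewrite ler_wpM2r//.
  by rewrite /K'; have := ler_norm K; lra.
have [fn [fnt fnd]] := sepdual_dense sD (dual_hahn_banach ts tK).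
have C0 : 0 < 8 * K' ^+ 2 by rewrite mulr_gt0// exprn_gt0.
(* With [s = sigma / (8 * K' ^+ 2)] the conjugate lies below [tau] by at most [sigma]; adding
   [sigma] puts it above. *)
have [P [Pt Pb]] := smooth_approx_aux ts K0 tK' fnt fnd (divr_gt0 s0 C0).
exists (fun x => P x + sigma); split.
  move=> x; have [g [gt gP gd]] := Pt x; exists g; split=> // [y|e e0].
    by have := gP y; lra.
  have [d d0 dP] := gd e e0; exists d => // y Dy yd.
  by have := dP y Dy yd; lra.
by move=> x; have := Pb x; rewrite divfK ?gt_eqF//; lra.
Qed.

(** * Geometric sequences and completeness *)

Section half_powers.
Context (R : realType).

Definition hpow n : R := 2^-1 ^+ n.

Lemma hpow0 : hpow 0 = 1. Proof. by rewrite /hpow expr0. Qed.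

Lemma hpowS n : hpow n.+1 = hpow n / 2.
Proof. by rewrite /hpow exprS mulrC. Qed.

Lemma hpow_gt0 n : 0 < hpow n. Proof. by rewrite exprn_gt0. Qed.

Lemma hpow_le1 n : hpow n <= 1.
Proof. by rewrite exprn_ile1// invf_le1//; lra. Qed.

Lemma hpow_small (C e : R) : 0 < e -> exists n, C * hpow n < e.
Proof.
move=> e0; have [C0|C0] := leP C 0.
  by exists 0%N; rewrite hpow0 mulr1 (le_lt_trans C0).
have eC : 0 < e / C by rewrite divr_gt0.
have h1 : `|2^-1 : R| < 1 by rewrite ger0_norm//; lra.
have /cvgrPdist_lt/(_ _ eC)[n _ /(_ n (leqnn n))] := cvg_expr h1.
rewrite /= sub0r normrN ger0_norm ?exprn_ge0// => ne.
by exists n; rewrite mulrC -ltr_pdivlMr.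
Qed.

Lemma le_hpow (a b C : R) : (forall n, a <= b + C * hpow n) -> a <= b.
Proof.
move=> abC; apply/ler_addgt0Pr => e /(hpow_small C)[n ne].
by have := abC n; lra.
Qed.

End half_powers.
Arguments hpow {R}.

(* The library has no complete normed structure on products; completeness in
   this form passes to them. *)
Definition geo_complete (R : realType) (Z : normedModType R) :=
  forall (u : nat -> Z) (C : R),
    (forall n, `|u n.+1 - u n| <= C * hpow n) ->
    exists l, forall n, `|u n - l| <= 2 * C * hpow n.

Section completeness.
Context (R : realType).

Lemma geo_dist (Z : normedModType R) (u : nat -> Z) (C : R) n k :
  (forall n, `|u n.+1 - u n| <= C * hpow n) ->
  `|u (n + k)%N - u n| <= 2 * C * (hpow n - hpow (n + k)).
Proof.
move=> uC; elim: k => [|k IH]; first by rewrite addn0 !subrr normr0 mulr0.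
rewrite addnS hpowS.
have := ler_distD (u (n + k)%N) (u (n + k).+1) (u n).
by have := uC (n + k)%N; lra.
Qed.

Lemma geo_complete_normed (X : completeNormedModType R) : geo_complete X.
Proof.
move=> u C uC.
have C0 : 0 <= C.
  by have := uC 0%N; rewrite hpow0 mulr1; exact: le_trans.
have uk n k : `|u (n + k)%N - u n| <= 2 * C * hpow n.
  apply: le_trans (geo_dist n k uC) _; rewrite ler_wpM2l ?mulr_ge0//.
  by have := hpow_gt0 R (n + k); lra.
have uc : cvg (u @ \oo).
  apply: cauchy_cvg; apply/cauchy_ballP => e e0.
  have [n ne] := hpow_small (4 * C) e0.
  exists (u @` [set k | (n <= k)%N], u @` [set k | (n <= k)%N]) => /=.
    by split; exists n => // k nk; exists k.
  move=> [_ _] /= [[i ni <-] [j nj <-]]; rewrite -ball_normE/=.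
  apply: le_lt_trans (ler_distD (u n) _ _) _.
  rewrite -(subnKC ni) -(subnKC nj) [X in _ + X]distrC.
  by have := uk n (i - n)%N; have := uk n (j - n)%N; lra.
exists (lim (u @ \oo)) => n.
rewrite distrC; apply/ler_addgt0Pr => e e0.
have /cvgrPdist_lt/(_ _ e0)[N _ /(_ (n + N)%N (leq_addl _ _))] := uc.
rewrite /= => lN; apply: le_trans (ler_distD (u (n + N)%N) _ _) _.
by have := uk n N; lra.
Qed.

Lemma geo_complete_prod (X Y : normedModType R) :
  geo_complete X -> geo_complete Y -> geo_complete (X * Y)%type.
Proof.
move=> cX cY u C uC.
have [|l1 l1P] := cX (fun n => (u n).1) C.
  by move=> n; apply: le_trans (uC n); rewrite prod_normE le_max lexx.
have [|l2 l2P] := cY (fun n => (u n).2) C.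
  by move=> n; apply: le_trans (uC n); rewrite prod_normE le_max lexx orbT.
by exists (l1, l2) => n; rewrite prod_normE ge_max l1P l2P.
Qed.

Lemma closed_geo (Z : normedModType R) (S : set Z) (u : nat -> Z) l (C : R) :
  closed S -> (forall n, S (u n)) -> (forall n, `|u n - l| <= C * hpow n) ->
  S l.
Proof.
move=> Sc Su uC; apply: Sc => A /nbhs_ballP[e /= e0 eA].
have [n ne] := hpow_small C e0; exists (u n); split=> //; apply: eA.
by rewrite -ball_normE/= distrC (le_lt_trans (uC n)).
Qed.

End completeness.

(** * A smooth variational principle *)

Section variational_principle.
Context (R : realType) (Z : normedModType R).
Implicit Types (g : dual Z) (tau : Z -> R) (D : set Z).

Lemma tame_lipschitz D tau P x y : tame D tau P -> P y - P x <= tau (y - x).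
Proof.
move=> /(_ y)[g [gt gP _]]; have := gP x; rewrite -opprB dual_evalN.
by have := gt (y - x); lra.
Qed.

Section series.
Context (D : set Z) (m : R) (P : nat -> Z -> R) (z : nat -> Z) (z0 : Z).
Hypothesis m_gt0 : 0 < m.
Hypothesis P_tame : forall i, tame D (fun v => `|v|) (P i).
Hypothesis P_bnd : forall i x, 0 <= P i x <= `|x| + 1.
Hypothesis z_bnd : forall i, `|z i - z0| <= 1.

Let S n x := \sum_(i < n) m * hpow i.+1 * P i (x - z i).

Let SS n x : S n.+1 x = S n x + m * hpow n.+1 * P n (x - z n).
Proof. by rewrite /S big_ord_recr. Qed.

Let wgt_gt0 n : 0 < m * hpow n. Proof. by rewrite mulr_gt0// hpow_gt0. Qed.

Let S_mono n k x : S n x <= S (n + k) x.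
Proof.
elim: k => [|k IH]; first by rewrite addn0.
rewrite addnS SS (le_trans IH)// lerDl mulr_ge0 ?(ltW (wgt_gt0 _))//.
by case/andP: (P_bnd (n + k) (x - z (n + k)%N)).
Qed.

Let S_tail n k x :
  S (n + k) x <= S n x + m * (hpow n - hpow (n + k)) * (`|x - z0| + 2).
Proof.
elim: k => [|k IH]; first by rewrite addn0 subrr mulr0 mul0r addr0.
rewrite addnS SS.
have Pk : P (n + k) (x - z (n + k)%N) <= `|x - z0| + 2.
  have /andP[_ P2] := P_bnd (n + k) (x - z (n + k)%N).
  have := ler_distD z0 x (z (n + k)%N); rewrite [`|z0 - _|]distrC.
  by have := z_bnd (n + k); lra.
have := ler_wpM2l (ltW (wgt_gt0 (n + k).+1)) Pk.
by rewrite hpowS; lra.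
Qed.

Lemma series_lipschitz n k x y : S (n + k) y - S n y <=
  S (n + k) x - S n x + m * (hpow n - hpow (n + k)) * `|y - x|.
Proof.
elim: k => [|k IH]; first by rewrite addn0 !subrr mulr0 mul0r addr0.
rewrite addnS !SS.
have := tame_lipschitz (x - z (n + k)%N) (y - z (n + k)%N) (P_tame (n + k)).
rewrite opprB addrA subrK => /(ler_wpM2l (ltW (wgt_gt0 (n + k).+1))).
by rewrite hpowS; lra.
Qed.

(** The weights sum to at most [m], so the weighted sums [G n] of the derivatives of the terms have
    a weak-star cluster point, at distance at most [m * hpow n] from [G n]. The tail of the series
    is Lipschitz with the same small constant, so differentiability of finitely many terms suffices
    for each [e]. *)
Lemma tame_series : exists Delta : Z -> R, tame D (fun v => m * `|v|) Delta /\
  forall n x, S n x <= Delta x <= S n x + m * hpow n * (`|x - z0| + 2).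
Proof.
have S_ub n x N : S N x <= S n x + m * hpow n * (`|x - z0| + 2).
  have [nN|/ltnW Nn] := leqP n N.
    rewrite -(subnKC nN); apply: le_trans (S_tail n _ x) _.
    rewrite lerD2l ler_wpM2r ?addr_ge0// ler_pM2l//.
    by have := hpow_gt0 R (n + (N - n)); lra.
  rewrite -(subnKC Nn); apply: le_trans (S_mono N (n - N) x) _.
  by rewrite lerDl mulr_ge0 ?addr_ge0// ltW.
pose Delta x := sup [set S n x | n in setT].
have Dsup x : has_sup [set S n x | n in setT].
  split; first by exists (S 0 x), 0%N.
  by exists (S 0 x + m * hpow 0 * (`|x - z0| + 2)) => _ [N _ <-]; exact: S_ub.
have D_ub n x : S n x <= Delta x.
  by apply: ub_le_sup; [case: (Dsup x)|exists n].
have D_le x c : (forall n, S n x <= c) -> Delta x <= c.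
  by move=> Sc; apply: ge_sup => [|_ [n _ <-]//]; case: (Dsup x).
have D_bnd n x : Delta x <= S n x + m * hpow n * (`|x - z0| + 2).
  by apply: D_le => N; exact: S_ub.
have D_lip n x y :
    Delta y - S n y <= Delta x - S n x + m * hpow n * `|y - x|.
  rewrite lerBlDr; apply: D_le => N; apply: le_trans (S_mono N n y) _.
  rewrite addnC; have := series_lipschitz n N x y; have := D_ub (n + N)%N x.
  have := mulr_ge0 (ltW (wgt_gt0 (n + N))) (normr_ge0 (y - x)).
  by lra.
exists Delta; split => [x|n x]; last by rewrite D_ub D_bnd.
have gex i : exists g : dual Z,
    [/\ forall v, g v <= `|v|,
     forall y, P i (x - z i) + g (y - x) <= P i (y - z i) &
     forall e, 0 < e -> exists2 d, 0 < d & forall y, D (y - x) ->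
      `|y - x| < d -> P i (y - z i) <=
        P i (x - z i) + g (y - x) + e * `|y - x|].
  have [g [g1 g2 g3]] := P_tame i (x - z i).
  have sub y : y - z i - (x - z i) = y - x by rewrite opprB addrA subrK.
  exists g; split=> // [y|e e0]; first by have := g2 (y - z i); rewrite sub.
  have [d d0 dP] := g3 e e0; exists d => // y Dy yd.
  by have := dP (y - z i); rewrite sub; exact.
have [g gP] := choice gex.
have gabs i v : `|g i v| <= `|v|.
  have [g1 _ _] := gP i.
  have := @dual_le_abs R Z (fun v => `|v|) 1 (g i) v _ g1.
  by rewrite mul1r; apply=> w; rewrite mul1r.
pose G n : dual Z := \sum_(i < n) (m * hpow i.+1) *: g i.
have GS n v : G n.+1 v = G n v + m * hpow n.+1 * g n v :> R.
  by rewrite /G big_ord_recr.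
have G0 v : G 0%N v = 0 :> R by rewrite /G big_ord0 dual0.
have Gtail n k v :
    `|G (n + k)%N v - G n v| <= m * (hpow n - hpow (n + k)) * `|v|.
  elim: k => [|k IH]; first by rewrite addn0 !subrr normr0 mulr0 mul0r.
  rewrite addnS GS addrAC; apply: le_trans (ler_normD _ _) _.
  rewrite normrM (ger0_norm (ltW (wgt_gt0 _))).
  have := ler_wpM2l (ltW (wgt_gt0 (n + k).+1)) (gabs (n + k)%N v).
  by rewrite hpowS; lra.
have Gle n v : G n v <= m * `|v|.
  have := Gtail 0%N n v; rewrite add0n G0 subr0 hpow0 => Gn.
  have := mulr_ge0 (ltW (wgt_gt0 n)) (normr_ge0 v).
  by have := ler_norm (G n v); lra.
have [|gg [U [UP FU ggt Ugg]]] := @dual_cluster R Z (fun v => m * `|v|) m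
    (G @ \oo) (fmap_proper_filter _ eventually_filter) (fun=> lexx _).
  suff H : \forall n \near \oo, forall v, G n v <= m * `|v| by exact: H.
  by near=> n.
have ggG n v : `|gg v - G n v| <= m * hpow n * `|v|.
  apply/ler_addgt0Pr => e e0.
  have UF : Filter U by typeclasses eauto.
  have Un : U [set f : dual Z | exists k, f = G (n + k)%N].
    apply: FU; suff H : \forall k \near \oo, exists j, G k = G (n + j)%N.
      exact: H.
    by exists n => // k /= nk; exists (k - n)%N; rewrite subnKC.
  have /filter_ex[f [/= + [k fE]]] := @filterI _ U UF _ _ (Ugg v e e0) Un.
  rewrite fE => fg.
  have := ler_distD (G (n + k)%N v) (gg v) (G n v).
  rewrite [`|gg v - G (n + k)%N v|]distrC; have := Gtail n k v.
  have := mulr_ge0 (ltW (wgt_gt0 (n + k))) (normr_ge0 v).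
  by move: fg; rewrite /=; lra.
exists gg; split => // [y|e e0].
  apply: (@le_hpow R _ _ (m * `|y - x| + m * (`|x - z0| + 2))) => n.
  have Sn : S n x + G n (y - x) <= S n y.
    elim: n => [|n IH]; first by rewrite /S !big_ord0 G0 addr0.
    have [_ g2 _] := gP n; rewrite !SS GS.
    by have := ler_wpM2l (ltW (wgt_gt0 n.+1)) (g2 y); lra.
  have := D_bnd n x; have := D_ub n y; have := ggG n (y - x).
  rewrite ler_norml => /andP[_]; lra.
(* The tails of [Delta] and of its derivative each cost at most [e / 4] per unit of distance, which
   leaves [e / 2] for the first [n] terms. *)
have [n ne] := @hpow_small R (4 * m) e e0.
have e20 : 0 < e / (2 * m) by rewrite divr_gt0// mulr_gt0.
have [d d0 dS] : exists2 d, 0 < d & forall y, D (y - x) -> `|y - x| < d ->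
    S n y <= S n x + G n (y - x) + (1 - hpow n) * (e / 2) * `|y - x|.
  elim: (n) => [|k [d d0 dP]].
    exists 1 => // y _ _; rewrite /S !big_ord0 G0 hpow0; lra.
  have [_ _ /(_ _ e20)[d' d'0 d'P]] := gP k.
  exists (Num.min d d') => [|y Dy]; first by rewrite lt_min d0.
  rewrite lt_min => /andP[/(dP y Dy) S1 /(d'P y Dy) S2].
  rewrite !SS GS; have := ler_wpM2l (ltW (wgt_gt0 k.+1)) S2.
  have -> : m * hpow k.+1 * (P k (x - z k) + g k (y - x) +
      e / (2 * m) * `|y - x|) = m * hpow k.+1 * P k (x - z k) +
      m * hpow k.+1 * g k (y - x) + hpow k.+1 * (e / 2) * `|y - x|.
    by field; rewrite gt_eqF.
  by move: S1; rewrite hpowS; lra.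
exists d => // y Dy yd.
have := dS y Dy yd; have := D_lip n x y; have := ggG n (y - x).
rewrite ler_norml => /andP[+ _].
have := ler_wpM2r (normr_ge0 (y - x)) (ltW ne).
have := mulr_ge0 (ltW (hpow_gt0 R n)) (mulr_ge0 (ltW e0) (normr_ge0 (y - x))).
lra.
Unshelve. all: by end_near.
Qed.

End series.

(* A smooth variational principle in the style of Borwein and Preiss. Each point
   is an almost minimiser of the last perturbed function over the whole of S, so
   the perturbations P need not attain their minimum at the origin. *)
Lemma variational_principle (S D : set Z) (phi : Z -> R) z0 (K m r : R) :
  geo_complete Z -> closed S -> S z0 ->
  (forall x y, phi x - phi y <= K * `|x - y|) -> 0 < m -> 0 < r -> r <= 1 ->
  (forall y, S y -> phi z0 <= phi y + m * r / 16) ->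
  (forall sigma, 0 < sigma -> exists P, tame D (fun v => `|v|) P /\
     forall x, `|x| <= P x <= `|x| + sigma) ->
  exists z Delta, [/\ S z, `|z - z0| <= r, tame D (fun v => m * `|v|) Delta &
    forall y, S y -> phi z + Delta z <= phi y + Delta y].
Proof.
move=> Zc Sc Sz0 phiK m0 r0 r1 phiz0 HP.
(* The tolerances decrease like [4^-n] and the weights of the perturbations like [2^-n]; the steps,
   bounded by quotients of the two, therefore decrease geometrically. *)
pose eps n := m * r * (hpow n * hpow n) / 16.
have eps_gt0 n : 0 < eps n by rewrite divr_gt0// !mulr_gt0 ?hpow_gt0.
pose sig n : R := r * hpow n / 4.
have sig_gt0 n : 0 < sig n by rewrite divr_gt0// mulr_gt0 ?hpow_gt0.
have [P PP] := choice (fun n => HP (sig n) (sig_gt0 n)).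
pose pick (F : Z -> R) e :=
  xget z0 [set z | S z /\ forall y, S y -> F z <= F y + e].
have pick_spec F e b : 0 < e -> (forall y, S y -> b <= F y) ->
    S (pick F e) /\ forall y, S y -> F (pick F e) <= F y + e.
  move=> e0 Fb; rewrite /pick; case: xgetP => [z _ []//|nz].
  have Fi : has_inf [set F y | y in S].
    by split; [exists (F z0), z0|exists b => _ [y Sy <-]; exact: Fb].
  have [_ [z Sz <-] ze] := inf_adherent e0 Fi.
  case: (nz z); split=> // y Sy.
  have : inf [set F y | y in S] <= F y.
    by apply: ge_inf; [case: Fi|exists y].
  lra.
(* The state consists of the current point and the current perturbed function; the new perturbation
   is centred at the current point and penalises leaving it. *)
pose next n (s : Z * (Z -> R)) : Z * (Z -> R) :=
  let F x := s.2 x + m * hpow n.+1 * P n (x - s.1) in (pick F (eps n.+1), F).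
pose st := fix st n := if n is k.+1 then next k (st k) else (z0, phi).
pose z n := (st n).1; pose F n := (st n).2.
have FS n x : F n.+1 x = F n x + m * hpow n.+1 * P n (x - z n) by [].
have wgt_gt0 n : 0 < m * hpow n by rewrite mulr_gt0// hpow_gt0.
have P0 n x : 0 <= P n x.
  by have [_ /(_ x)/andP[+ _]] := PP n; exact: le_trans.
have Flb n y : S y -> phi z0 - m * r / 16 <= F n y.
  elim: n y => [|n IH] y Sy; first by have := phiz0 y Sy; rewrite /F/=; lra.
  rewrite FS (le_trans (IH y Sy))// lerDl mulr_ge0// ltW//.
have zP n : S (z n) /\ forall y, S y -> F n (z n) <= F n y + eps n.
  case: n => [|n]; last exact: (pick_spec _ _ _ (eps_gt0 n.+1) (Flb n.+1)).
  split=> // y Sy; rewrite /eps hpow0 !mulr1; exact: phiz0.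
have zstep n : `|z n.+1 - z n| <= r / 2 * hpow n.
  have [Szn _] := zP n; have [Sz1 /(_ _ Szn)] := zP n.+1.
  have [_ /(_ _ Sz1)] := zP n; rewrite !FS subrr.
  have [_ PPn] := PP n.
  have /andP[_] := PPn 0; rewrite normr0 add0r.
  move=> /(ler_wpM2l (ltW (wgt_gt0 n.+1))).
  have /andP[+ _] := PPn (z n.+1 - z n).
  move=> /(ler_wpM2l (ltW (wgt_gt0 n.+1))) q1 q2 q3 q4.
  have {q1 q2 q3 q4} : m * hpow n.+1 * `|z n.+1 - z n| <=
      eps n + eps n.+1 + m * hpow n.+1 * sig n by lra.
  have -> : eps n + eps n.+1 + m * hpow n.+1 * sig n =
      m * hpow n.+1 * (r * hpow n * (13 / 32)).
    by rewrite /eps /sig hpowS; field.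
  rewrite ler_pM2l// => /le_trans; apply.
  by have := mulr_gt0 r0 (hpow_gt0 R n); lra.
have [l lP] := Zc z (r / 2) zstep.
have {}lP n : `|z n - l| <= r * hpow n.
  by have := lP n; rewrite mulrCA divff// mulr1.
have Sl : S l by apply: (closed_geo Sc _ lP) => n; case: (zP n).
have Ptame i : tame D (fun v => `|v|) (P i) by case: (PP i).
have Pbnd i x : 0 <= P i x <= `|x| + 1.
  rewrite P0/=; have [_ /(_ x)/andP[_]] := PP i.
  move=> /le_trans; apply; rewrite lerD2l /sig ler_pdivrMr// mul1r.
  have := hpow_le1 R i; have := hpow_gt0 R i; nra.
have zbnd i : `|z i - l| <= 1.
  apply: le_trans (lP i) _.
  have := hpow_le1 R i; have := hpow_gt0 R i; nra.
have [Delta [Dt DP]] := tame_series m0 Ptame Pbnd zbnd.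
exists l, Delta; split=> //.
  by have := lP 0%N; rewrite hpow0 mulr1 distrC.
have FE n x : F n x = phi x + \sum_(i < n) m * hpow i.+1 * P i (x - z i).
  elim: n => [|n IH]; first by rewrite big_ord0 addr0.
  by rewrite FS IH big_ord_recr/= addrA.
move=> y Sy.
(* The four terms come from the tail of [Delta] at [l], from moving the partial sum and [phi] from
   [z n] to [l], and from the tolerance [eps n]. *)
apply: (@le_hpow R _ _ (2 * m + m * r + `|K| * r + m * r)) => n.
have /andP[_] := DP n l; rewrite subrr normr0 add0r.
have /andP[+ _] := DP n y.
have := phiK l (z n).
have [_ /(_ y Sy)] := zP n; rewrite !FE.
have := series_lipschitz z m0 Ptame 0 n (z n) l.
rewrite !add0n !big_ord0 !subr0 hpow0 [`|l - z n|]distrC.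
set a := \sum_(i < n) _; set b := \sum_(i < n) _; set c := \sum_(i < n) _.
have := lP n; have h0 := hpow_gt0 R n; have h1 := hpow_le1 R n.
move=> zl.
have m1 : m * (1 - hpow n) * `|z n - l| <= m * (r * hpow n).
  rewrite -mulrA ler_pM2l// (le_trans _ zl)// ler_piMl//; lra.
have m2 : K * `|z n - l| <= `|K| * (r * hpow n).
  apply: (@le_trans _ _ (`|K| * `|z n - l|)).
    by rewrite ler_wpM2r// ler_norm.
  by rewrite ler_wpM2l.
have m3 : eps n <= m * r * hpow n.
  rewrite /eps; have : 0 < m * r by rewrite mulr_gt0.
  move: (m * r) => mr mr0.
  have : mr * (hpow n * hpow n) <= mr * hpow n.
    by rewrite ler_pM2l// ler_piMl// ltW.
  have := mulr_gt0 mr0 h0; lra.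
by move=> *; lra.
Qed.

End variational_principle.

(** * Countably generated sets and Asplund spaces *)

Lemma countable_op_closure (T : Type) (I : countType) (op : I -> T -> T -> T)
    (D0 : set T) : countable D0 ->
  exists D, [/\ D0 `<=` D, countable D &
    forall i x y, D x -> D y -> D (op i x y)].
Proof.
move=> D0c.
pose step (A : set T) := A `|` \bigcup_(i in setT) \bigcup_(x in A)
  \bigcup_(y in A) [set op i x y].
pose D := fix D n := if n is k.+1 then step (D k) else D0.
have Dmono n k : D n `<=` D (n + k)%N.
  elim: k => [|k IH x Dx]; first by rewrite addn0.
  by rewrite addnS; left; exact: IH.
exists (\bigcup_n D n); split=> [x Dx||i x y [n _ Dx] [k _ Dy]].
- by exists 0%N.
- apply: bigcup_countable => // n _; elim: n => [//|n IH] /=.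
  rewrite /step -bigcup2E; apply: bigcup_countable => // -[|[|j]] _ //=.
  by do 3 (apply: bigcup_countable => // ? _); exact: countable1.
- exists (n + k).+1 => //; right; exists i => //; exists x; first exact: Dmono.
  by exists y => //; rewrite addnC; exact: Dmono.
Qed.

Section asplund_spaces.
Context (R : realType).

Definition rat_closed (Z : normedModType R) (D : set Z) := forall (p q : rat) x y,
  D x -> D y -> D (ratr p *: x + ratr q *: y).

(* The form of Asplundness that is used: it passes to products. *)
Definition asp (Z : normedModType R) := forall D : set Z,
  countable D -> rat_closed D -> sepdual D.

Lemma asp_prod (X Y : normedModType R) : asp X -> asp Y -> asp (X * Y)%type.
Proof.
move=> aX aY D Dc Dr e e0; have e20 : 0 < e / 2 by rewrite divr_gt0.
have D1 : sepdual [set p.1 | p in D].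
  apply: aX; first by apply: sub_countable Dc; exact: card_image_le.
  by move=> p q _ _ [x Dx <-] [y Dy <-]; exists (ratr p *: x + ratr q *: y);
    first exact: Dr.
have D2 : sepdual [set p.2 | p in D].
  apply: aY; first by apply: sub_countable Dc; exact: card_image_le.
  by move=> p q _ _ [x Dx <-] [y Dy <-]; exists (ratr p *: x + ratr q *: y);
    first exact: Dr.
have [c1 c1P] := D1 _ e20; have [c2 c2P] := D2 _ e20.
have res (f : dual (X * Y)%type) : exists r : dual X * dual Y,
    forall p, f p = r.1 p.1 + r.2 p.2.
  by have [f1 [f2 [_ _ fE]]] := dual_components f; exists (f1, f2).
have [r rE] := choice res.
exists (fun f => pickle (c1 (r f).1, c2 (r f).2)) => f g fg u Du.
have /(f_equal (@unpickle (nat * nat)%type)) := fg.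
rewrite !pickleK => -[fg1 fg2].
have := c1P _ _ fg1 u.1 (ex_intro2 _ _ u Du (erefl _)).
have := c2P _ _ fg2 u.2 (ex_intro2 _ _ u Du (erefl _)).
have : `|u.1| <= `|u| by rewrite prod_normE le_max lexx.
have : `|u.2| <= `|u| by rewrite prod_normE le_max lexx orbT.
move=> /(ler_wpM2l (ltW e20)) u2 /(ler_wpM2l (ltW e20)) u1.
rewrite !rE opprD addrACA => q2 q1.
by apply: le_trans (ler_normD _ _) _; lra.
Qed.

Lemma closure_approx (Z : normedModType R) (D : set Z) u (e : R) : closure D u ->
  0 < e -> exists2 v, D v & `|v - u| < e.
Proof.
move=> Du e0; have [v [Dv uv]] := Du _ (nbhsx_ballx u e e0).
by exists v => //; move: uv; rewrite -ball_normE/= distrC.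
Qed.

Lemma approx_closure (Z : normedModType R) (D : set Z) u :
  (forall e : R, 0 < e -> exists2 v, D v & `|v - u| < e) -> closure D u.
Proof.
move=> uD A /nbhs_ballP[e /= e0 eA]; have [v Dv vu] := uD e e0.
by exists v; split=> //; apply: eA; rewrite -ball_normE/= distrC.
Qed.

Lemma closureB (Z : normedModType R) (D : set Z) x y : rat_closed D ->
  closure D x -> closure D y -> closure D (x - y).
Proof.
move=> Dr Dx Dy; apply: approx_closure => e e0.
have e20 : 0 < e / 2 by rewrite divr_gt0.
have [v Dv vx] := closure_approx Dx e20; have [w Dw wy] := closure_approx Dy e20.
have m1 : ratr (-1) = -1 :> R by rewrite rmorphN rmorph1.
exists (v - w).
  by have := Dr 1 (-1) v w Dv Dw; rewrite m1 rmorph1 scale1r scaleN1r.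
have -> : v - w - (x - y) = (v - x) - (w - y).
  by rewrite opprD opprK addrACA opprB [y - w]addrC.
by apply: le_lt_trans (ler_normB _ _) _; lra.
Qed.

Lemma closure_linear (Z : normedModType R) (D : set Z) (a : R) x y :
  rat_closed D -> closure D x -> closure D y -> closure D (a *: x + y).
Proof.
move=> Dr Dx Dy; apply: approx_closure => e e0.
have e30 : 0 < e / 3 by rewrite divr_gt0.
have x0 : 0 < `|x| + 1 by rewrite ltr_wpDl.
have d0 : 0 < e / 3 / (`|x| + 1) by rewrite divr_gt0.
have [q] : exists q : rat, ratr q \in `]a, (a + e / 3 / (`|x| + 1))[.
  by apply: rat_in_itvoo; rewrite ltrDl.
rewrite in_itv/=; have := Dr q 1; rewrite rmorph1.
move: (ratr q) => p Dp /andP[aq qa].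
have q0 : 0 < `|p| + 1 by rewrite ltr_wpDl.
have d'0 : 0 < e / 3 / (`|p| + 1) by rewrite divr_gt0.
have [v Dv vx] := closure_approx Dx d'0; have [w Dw wy] := closure_approx Dy e30.
exists (p *: v + w).
  by have := Dp v w Dv Dw; rewrite scale1r.
have -> : p *: v + w - (a *: x + y) =
    (p *: (v - x) + (p - a) *: x) + (w - y).
  by rewrite scalerBr scalerBl subrKA opprD addrACA.
apply: le_lt_trans (ler_normD _ _) _.
apply: le_lt_trans (lerD (ler_normD _ _) (lexx _)) _.
rewrite !normrZ (ger0_norm (_ : 0 <= p - a)); last by lra.
have : `|p| * `|v - x| <= e / 3.
  apply: (@le_trans _ _ ((`|p| + 1) * (e / 3 / (`|p| + 1)))).
    by rewrite ler_pM// ?ltW// ltrDl.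
  by rewrite mulrC divfK// gt_eqF.
have : (p - a) * `|x| <= e / 3.
  apply: (@le_trans _ _ ((e / 3 / (`|x| + 1)) * (`|x| + 1))).
    by rewrite ler_pM//; lra.
  by rewrite divfK// gt_eqF.
move: (_ * `|x|) (_ * `|v - x|) => A B A3 B3. lra.
Qed.

Lemma sepdual_closure (Z : normedModType R) (D : set Z) :
  sepdual D -> sepdual (closure D).
Proof.
move=> sD e e0; have [c cP] := sD e e0; exists c => f g fg u Du.
apply/ler_addgt0Pr => d d0.
pose C := `|f| + `|g| + e; have C0 : 0 < C + 1.
  by rewrite ltr_wpDl// addr_ge0 ?addr_ge0// ltW.
have [v Dv vu] := closure_approx Du (divr_gt0 d0 C0).
have := cP f g fg v Dv.
have : `|f u - g u| <= `|f (u - v)| + `|g (u - v)| + `|f v - g v|.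
  rewrite !dual_evalB; have -> : f u - g u = (f u - f v) - (g u - g v) + (f v - g v).
    by ring.
  by apply: le_trans (ler_normD _ _) _; rewrite lerD2r ler_normB.
have := dual_normP f (u - v); have := dual_normP g (u - v).
have : `|v| <= `|u| + `|v - u| by have := ler_normD u (v - u); rewrite addrC subrK.
move=> /(ler_wpM2l (ltW e0)).
rewrite [`|u - v|]distrC.
have : (C + 1) * `|v - u| <= d.
  by rewrite mulrC -ler_pdivlMr// ltW.
rewrite /C; change (dual_norm f) with `|f|; change (dual_norm g) with `|g|.
have := normr_ge0 (v - u); lra.
Qed.

(** The closure of [D] is a separable linear subspace. A functional is classified by a member of a
    countable dense subset of the dual of this subspace that is within [e / 2] of its restriction;
    functionals in the same class then differ by less than [e] in norm there. *)
Lemma asplund_asp (X : completeNormedModType R) : asplund X -> asp X.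
Proof.
move=> aX D Dc Dr.
have [->|/set0P[x0 Dx0]] := eqVneq D set0.
  by move=> e e0; exists (fun=> 0%N) => f g _ u.
pose P : {pred X} := mem (closure D).
have P_submod : submod_closed P.
  have c0 : closure D 0.
    apply: subset_closure; have := Dr 0 0 x0 x0 Dx0 Dx0.
    by rewrite rmorph0 scale0r addr0.
  split=> [|a x y /set_mem xD /set_mem yD]; apply/mem_set => //.
  exact: closure_linear.
pose U : submodClosed X :=
  HB.pack P (GRing.isSubmodClosed.Build R X P P_submod).
have UD (u : linsub U) : closure D (val u) by apply/set_mem/(valP u).
have sU : separable (linsub U).
  exists [set u : linsub U | D (val u)].
    have /countable_injP[f fi] := Dc.
    apply/countable_injP; exists (fun u => f (val u)) => u v.
    by rewrite !inE /= => Du Dv /fi; rewrite !inE => /(_ Du Dv)/val_inj.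
  move=> O [u Ou] Oo.
  have /nbhs_ballP[e /= e0 eO] : nbhs u O by exact: open_nbhs_nbhs.
  have [v Dv vu] := closure_approx (UD u) e0.
  have vU : v \in U by apply/mem_set; exact: subset_closure.
  exists (Linsub vU); split=> //; apply: eO; rewrite -ball_normE/= distrC.
  exact: vu.
have [Ds /countable_injP[inj injP] Dsd] := aX U sU.
have res (f : dual X) : exists g : dual (linsub U), forall u, g u = f (val u).
  apply: (@mk_dual R (linsub U) (fun u => f (val u)) `|f|) => [a x y|x].
    by rewrite -(dual_evalP f).
  by apply: le_trans (ler_norm _) _; exact: dual_normP.
have [r rE] := choice res.
move=> e e0; have e20 : 0 < e / 2 by rewrite divr_gt0.
have near (f : dual X) : exists g, Ds g /\ `|r f - g| < e / 2.
  have [||g [gf Dg]] := Dsd (ball (r f) (e / 2)).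
  - by exists (r f); exact: ballxx.
  - exact: ball_open.
  by exists g; split=> //; move: gf; rewrite -ball_normE.
have [n nP] := choice near.
exists (fun f => inj (n f)) => f g fg u Du.
have {}fg : n f = n g by apply: injP => //; apply/mem_set; case: (nP f); case: (nP g).
have uU : u \in U by apply/mem_set; exact: subset_closure.
have -> : f u - g u = (r f - r g) (Linsub uU) by rewrite dualD dualN !rE.
apply: le_trans (dual_normP _ _) _.
change (dual_norm (r f - r g)) with `|r f - r g|.
change (`|Linsub uU|) with `|u|; rewrite ler_wpM2r//.
have [_ nf] := nP f; have [_ ng] := nP g.
apply: le_trans (ler_distD (n f) _ _) _; rewrite {2}fg [X in _ + X]distrC.
by lra.
Qed.

End asplund_spaces.

(** Clearing the denominator lets [u = z] be included, as both sides vanish there, and covers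
    isolated points uniformly. *)
Lemma frechet_normalP (R : realType) (Z : normedModType R) (S : set Z) z zs :
  frechet_normal S z zs <-> S z /\ forall e : R, 0 < e -> exists2 d, 0 < d &
    forall u, S u -> `|u - z| < d -> zs (u - z) <= e * `|u - z|.
Proof.
split=> -[Sz zN]; split=> //.
  move=> e e0.
  have : (limf_esup (fun u => (zs (u - z) / `|u - z|)%:E)
     (within (S `\ z) (nbhs z)) < e%:E)%E by apply: le_lt_trans zN _; rewrite lte_fin.
  move=> /ereal_inf_lt[_ [V /nbhs_ballP[d /= d0 dV] <-] Ve].
  exists d => // u Su ud; have [->|uz] := eqVneq u z.
    by rewrite subrr dual_eval0 normr0 mulr0.
  have Vu : V u.
    apply: dV; first by rewrite -ball_normE/= distrC.
    by split=> // /eqP; rewrite (negbTE uz).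
  have u0 : 0 < `|u - z| by rewrite normr_gt0 subr_eq0.
  rewrite -ler_pdivrMr// -lee_fin; apply: le_trans (ltW Ve).
  by apply: ereal_sup_ubound; exists u.
apply/lee_addgt0Pr => e e0; rewrite add0e.
have [d d0 dP] := zN e e0.
apply: ge_ereal_inf; exists (ereal_sup [set (zs (u - z) / `|u - z|)%:E |
    u in [set u | S u /\ u <> z /\ `|u - z| < d]]).
  exists [set u | S u /\ u <> z /\ `|u - z| < d] => //.
  apply/nbhs_ballP; exists d => // u; rewrite -ball_normE/= distrC => ud [Su uz].
  by rewrite /=; split; [|split].
apply: ge_ereal_sup => _ [u [Su [/eqP uz ud]] <-].
have u0 : 0 < `|u - z| by rewrite normr_gt0 subr_eq0.
by rewrite lee_fin ler_pdivrMr// dP.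
Qed.

(** * Lifting Frechet normals from the trace on a separable subspace *)

Section separable_reduction.
Context (R : realType) (Z : normedModType R).
Context (S : set Z) (tau : Z -> R) (K : R) (E : Z -> Z).
Hypothesis tau_sublinear : sublinear tau.
Hypothesis K_ge0 : 0 <= K.
Hypothesis tau_le : forall x, tau x <= K * `|x|.
Hypothesis E_lip : forall x y, `|E x - E y| <= 2 * `|x - y|.

(* An entry ((c, (n, k)), u) stands for the constraint
   "zeta (u - z) <= |u - z| / (n + 1) if |u - z| < 1 / (k + 1)" on a normal
   zeta to S at z, taken with the weight c. *)
Let entry := (R * (nat * nat) * Z)%type.
Implicit Types (x : entry) (fam : seq entry) (z : Z).

Let wgt x : R := x.1.1.
Let tol x : R := x.1.2.1.+1%:R^-1.
Let rad x : R := x.1.2.2.+1%:R^-1.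

Let cost z fam := \sum_(x <- fam) wgt x * (`|x.2 - z| * tol x).
Let shift z fam := \sum_(x <- fam) wgt x *: (x.2 - z).
(** A functional below [tau] that satisfies the constraints in [fam] is at most [expr z fam] at
    [E z]: it is at most [cost] on [shift] and at most [tau] on the remainder. A family with
    [expr z fam < |E z| / 2] thus certifies that no such functional reaches [|E z| / 2] at [E z]. *)
Let expr z fam := cost z fam + tau (E z - shift z fam).
(** The factor [a] leaves room to move the base point: 1/2 at [z] becomes 3/4 at a nearby point of
    the countable set, and at most 1 on the way back. *)
Let good (a : R) z fam := forall x, x \in fam ->
  [/\ 0 <= wgt x, S x.2 & `|x.2 - z| < a * rad x].

(** Violations are indexed by natural numbers only, namely the keys, a bound on the total weight and
    a margin, so countably many operations pick witnesses at every point. *)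
Let viol (l : seq (nat * nat)) (b t : nat) z : set (seq entry) := [set fam |
  [/\ map (fun x => x.1.2) fam = l, good (3 / 4) z fam,
      \sum_(x <- fam) wgt x <= b%:R &
      expr z fam + 2 * t.+1%:R^-1 < `|E z| / 2]].

Let witness (l : seq (nat * nat)) (b t i : nat) z : Z :=
  nth 0 (map snd (xget [::] (viol l b t z))) i.

Let op (i : (seq (nat * nat) * (nat * nat * nat)) + (rat * rat)) (x y : Z) : Z :=
  match i with
  | inl (l, (b, t, i)) => witness l b t i x
  | inr (p, q) => ratr p *: x + ratr q *: y
  end.

Let tol_gt0 x : 0 < tol x. Proof. by rewrite invr_gt0. Qed.
Let tol_le1 x : tol x <= 1. Proof. by rewrite invf_le1// ler1n. Qed.

(** A bound on the total weight gives a Lipschitz constant in the base point common to all families,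
    so violations can be carried between [z] and nearby points. *)
Let expr_lip z w fam (b : R) : (forall x, x \in fam -> 0 <= wgt x) ->
  \sum_(x <- fam) wgt x <= b ->
  expr w fam <= expr z fam + (b + K * (2 + b)) * `|w - z|.
Proof.
move=> wgt0 wgtb.
have wgts0 : 0 <= \sum_(x <- fam) wgt x.
  by rewrite big_seq; apply: sumr_ge0.
have costE : cost w fam <= cost z fam + (\sum_(x <- fam) wgt x) * `|w - z|.
  rewrite /cost mulr_suml -big_split/= big_seq [leRHS]big_seq; apply: ler_sum => x xf.
  rewrite -mulrDr ler_wpM2l ?wgt0//.
  have : `|x.2 - w| <= `|x.2 - z| + `|w - z|.
    by rewrite [`|w - z|]distrC ler_distD.
  move=> /(ler_wpM2r (ltW (tol_gt0 x))).
  have := ler_wpM2l (normr_ge0 (w - z)) (tol_le1 x); lra.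
have shiftE : shift w fam = shift z fam - (\sum_(x <- fam) wgt x) *: (w - z).
  rewrite scaler_suml -sumrB; apply: eq_bigr => x _.
  by rewrite -scalerBr opprB addrA subrK.
have tauE : tau (E w - shift w fam) <= tau (E z - shift z fam) +
    K * (2 + \sum_(x <- fam) wgt x) * `|w - z|.
  have -> : E w - shift w fam = (E z - shift z fam) +
     ((E w - E z) + (\sum_(x <- fam) wgt x) *: (w - z)).
    rewrite shiftE opprB [RHS]addrA [E z - _ + _]addrC subrKA.
    by rewrite addrA [LHS]addrAC.
  apply: le_trans (tau_sublinear.1 _ _) _; rewrite lerD2l.
  apply: le_trans (tau_le _) _; rewrite -mulrA ler_wpM2l// mulrDl.
  apply: le_trans (ler_normD _ _) _.
  by rewrite normrZ ger0_norm// lerD.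
have := ler_wpM2r (normr_ge0 (w - z)) wgtb.
move=> wb; have := ler_wpM2l K_ge0 wb.
by move: costE tauE wb; rewrite /expr; lra.
Qed.

Let dual_shift (f : dual Z) z fam :
  f (shift z fam) = \sum_(x <- fam) wgt x * f (x.2 - z) :> R.
Proof.
rewrite /shift; elim: fam => [|x fam IH]; first by rewrite !big_nil dual_eval0.
by rewrite !big_cons dual_evalP; congr (_ + _); exact: IH.
Qed.

Let E_lip2 z w : `|E z| / 2 <= `|E w| / 2 + `|z - w|.
Proof.
have := E_lip z w; have := ler_normD (E z - E w) (E w).
rewrite subrK; lra.
Qed.

Section one_point.
Context (D : set Z).
Hypothesis D_op : forall i u v, D u -> D v -> D (op i u v).
Variables (z : Z) (zeta : dual Z).
Hypotheses (S_z : S z) (D_z : closure D z).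
Hypothesis zeta_le : forall v, zeta v <= tau v.
Hypothesis zeta_E : `|E z| / 2 <= zeta (E z).
Variable k : nat -> nat.
Hypothesis kP : forall n u, (S `&` closure D) u -> `|u - z| < (k n).+1%:R^-1 ->
  zeta (u - z) <= `|u - z| * n.+1%:R^-1.

Let ok fam := good (1 / 2) z fam /\ forall x, x \in fam -> x.1.2.2 = k x.1.2.1.

(** A violation at [z] would persist at a nearby [w] in [D], where the selected violating family
    [fam'] has the same keys and its points in [D]. The constraints of [fam'] hold for [zeta], so
    moving back to [z] contradicts [zeta_E]. *)
Let expr_ge fam : ok fam -> `|E z| / 2 <= expr z fam.
Proof.
move=> [gfam kfam]; rewrite leNgt; apply/negP => viol_z.
have [t tP] : exists t : nat, t.+1%:R^-1 < (`|E z| / 2 - expr z fam) / 4.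
  have e0 : 0 < (`|E z| / 2 - expr z fam) / 4 by rewrite divr_gt0// subr_gt0.
  by have [t _ /(_ t (leqnn t))] := near_infty_natSinv_lt (PosNum e0); exists t.
have t0 : 0 < t.+1%:R^-1 :> R by rewrite invr_gt0.
set th : R := t.+1%:R^-1 in tP t0.
have wgts0 : 0 <= \sum_(x <- fam) wgt x.
  by rewrite big_seq; apply: sumr_ge0 => x /gfam[].
have [b bP] : exists b : nat, \sum_(x <- fam) wgt x <= b%:R.
  by exists (Num.bound (\sum_(x <- fam) wgt x)); exact: ltW (archi_boundP wgts0).
pose c := b%:R + K * (2 + b%:R) : R.
have c0 : 0 <= c by rewrite addr_ge0// mulr_ge0// addr_ge0.
pose km := \max_(x <- fam) x.1.2.2.
have km0 : 0 < km.+1%:R^-1 / 4 :> R by rewrite divr_gt0 ?invr_gt0.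
have radm x : x \in fam -> km.+1%:R^-1 <= rad x.
  move=> xf; rewrite lef_pV2 ?posrE// ler_nat ltnS.
  exact: (leq_bigmax_seq x xf).
(* The first bound keeps the points within the radii of the constraints. The second makes each
   change of base point cost less than [th]: the defect exceeds [4 * th] at [z], so a margin
   [2 * th] remains at [w], which is more than the way back costs. *)
pose ka := Num.min (km.+1%:R^-1 / 4) (th / (c + 1)).
have ka0 : 0 < ka by rewrite lt_min km0 divr_gt0// ltr_wpDl.
have [w Dw] := closure_approx D_z ka0.
rewrite lt_min => /andP[wkm]; rewrite ltr_pdivlMr ?ltr_wpDl// => wth.
have wz0 := normr_ge0 (w - z).
have violw : viol (map (fun x => x.1.2) fam) b t w fam.
  split=> // [x xf|].
    have [x0 Sx xz] := gfam x xf; split=> //.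
    have := ler_distD z x.2 w; rewrite [`|z - w|]distrC.
    have := radm x xf; move: xz wkm; move: (rad x) (km.+1%:R^-1) => r s. lra.
  have := @expr_lip z w fam b%:R (fun x xf => let: And3 h _ _ := gfam x xf in h) bP.
  by have := E_lip2 z w; rewrite [`|z - w|]distrC -/th -/c; lra.
pose fam' := xget [::] (viol (map (fun x => x.1.2) fam) b t w).
have [keyE gfam' wgtb' violw'] : viol (map (fun x => x.1.2) fam) b t w fam'.
  by apply: xgetI violw.
have Dfam' x : x \in fam' -> D x.2.
  move=> xf; have := D_op (inl (map (fun x => x.1.2) fam, (b, t, index x fam')))
    Dw Dw.
  by rewrite /op /witness (nth_map x)/= ?index_mem// nth_index.
have key' x : x \in fam' -> x.1.2.2 = k x.1.2.1 /\ km.+1%:R^-1 <= rad x.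
  move=> xf; have : x.1.2 \in map (fun x => x.1.2) fam.
    by rewrite -keyE; exact: (map_f (fun x : entry => x.1.2) xf).
  move=> /mapP[y yf xy]; rewrite /rad xy; split; first exact: kfam.
  exact: (radm y yf).
have zeta' x : x \in fam' -> zeta (x.2 - z) <= `|x.2 - z| * tol x.
  move=> xf; have [_ Sx xw] := gfam' x xf; have [xk radx] := key' x xf.
  apply: kP; first by split => //; apply: subset_closure; exact: Dfam'.
  rewrite -xk -/(rad x); have := ler_distD w x.2 z; move: xw radx wkm.
  move: (rad x) (km.+1%:R^-1) => r s; lra.
have : zeta (E z) <= expr z fam'.
  have -> : zeta (E z) = zeta (shift z fam') + zeta (E z - shift z fam') :> R.
    by rewrite -dual_evalD addrC subrK.
  rewrite lerD// dual_shift /cost big_seq [leRHS]big_seq.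
  apply: ler_sum => x xf; rewrite ler_wpM2l ?zeta'//.
  by case: (gfam' x xf).
have := @expr_lip w z fam' b%:R (fun x xf => let: And3 h _ _ := gfam' x xf in h) wgtb'.
have := E_lip2 w z; rewrite [`|z - w|]distrC -/c.
move: violw' wth t0 zeta_E; rewrite -/th.
move: (`|w - z|) (th) (c) (zeta (E z)) (expr w fam') (expr z fam').
move: (`|E w|) (`|E z|) => ew ez d h e zE fw fz; lra.
Qed.

Let scale (t : R) fam : seq entry := [seq (t * x.1.1, x.1.2, x.2) | x <- fam].

Let ok_scale t fam : 0 <= t -> ok fam -> ok (scale t fam).
Proof.
move=> t0 [gfam kfam]; split=> y /mapP[x xf ->]; last exact: (kfam x xf).
by have [x0 Sx xz] := gfam x xf; split=> //; exact: mulr_ge0.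
Qed.

Let cost_scale t fam : cost z (scale t fam) = t * cost z fam.
Proof.
by rewrite /cost big_map mulr_sumr; apply: eq_bigr => x _; rewrite mulrA.
Qed.

Let shift_scale t fam : shift z (scale t fam) = t *: shift z fam.
Proof.
by rewrite /shift big_map scaler_sumr; apply: eq_bigr => x _; rewrite scalerA.
Qed.

(** Scaling [fam] by a large factor would otherwise make [expr] negative, against [expr_ge]. *)
Let expr_ge0 fam : ok fam -> 0 <= cost z fam + tau (- shift z fam).
Proof.
move=> okf; rewrite leNgt; apply/negP; set X := cost _ _ + _ => X0.
pose T := (`|tau (E z)| + 1) / (- X).
have T0 : 0 <= T by rewrite divr_ge0 ?addr_ge0// oppr_ge0 ltW.
have := expr_ge (ok_scale T0 okf); rewrite /expr cost_scale shift_scale.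
have := tau_sublinear.1 (E z) (T *: - shift z fam).
rewrite (sublinearZ _ tau_sublinear T0) scalerN.
have TX : T * X = - (`|tau (E z)| + 1).
  by rewrite /T invrN mulrN mulNr divfK// lt_eqF.
move: TX; rewrite /X mulrDr.
have := ler_norm (tau (E z)); have := normr_ge0 (E z); lra.
Qed.

(** [sandwich] is applied to the cone generated by the entries and by the constraint
    [|E z| / 2 <= zeta' (E z)], taken with weight [s]. Compatibility with [tau] is [expr_ge] after
    division by [s] when [s > 0], and [expr_ge0] when [s = 0]. *)
Lemma lift_normal : exists zeta' : dual Z, [/\ frechet_normal S z zeta',
  forall v, zeta' v <= tau v & `|E z| / 2 <= zeta' (E z)].
Proof.
pose G v r := exists fam s, [/\ ok fam, 0 <= s, v = shift z fam - s *: E z &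
  r = cost z fam - s * (`|E z| / 2)].
have ok_nil : ok [::] by split.
have [|_ _ _ _ [f [s [fok s0 -> ->]]] [f' [s' [f'ok s'0 -> ->]]]|
    c _ _ c0 [f [s [fok s0 -> ->]]]|_ _ [f [s [fok s0 -> ->]]]|
    zeta' [zt zG]] := @sandwich R Z tau K G tau_sublinear tau_le.
- exists [::], 0; split=> //; first by rewrite /shift big_nil scale0r subr0.
  by rewrite /cost big_nil mul0r subr0.
- exists (f ++ f'), (s + s'); split; last 3 first.
  + exact: addr_ge0.
  + by rewrite /shift big_cat/= scalerDl opprD addrACA.
  + by rewrite /cost big_cat/= mulrDl opprD addrACA.
  + case: fok => g1 k1; case: f'ok => g2 k2.
    by split=> x; rewrite mem_cat => /orP[]; auto.
- exists (scale c f), (c * s); split.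
  + by apply: ok_scale => //; exact: ltW.
  + by rewrite mulr_ge0// ltW.
  + by rewrite shift_scale scalerBr scalerA.
  + by rewrite cost_scale mulrBr mulrA.
- rewrite opprB; move: s0; rewrite le_eqVlt => /predU1P[<-|s0].
    by rewrite scale0r mul0r subr0 sub0r expr_ge0.
  have si0 : 0 <= s^-1 by rewrite invr_ge0 ltW.
  have := expr_ge (ok_scale si0 fok); rewrite /expr cost_scale shift_scale.
  move=> /(ler_wpM2l (ltW s0)); rewrite mulrDr mulVKf ?gt_eqF//.
  rewrite -(sublinearZ _ tau_sublinear (ltW s0)) scalerBr scalerA.
  rewrite divff ?gt_eqF// scale1r; lra.
exists zeta'; split=> //; last first.
  rewrite -lerN2 -dual_evalN; apply: zG; exists [::], 1; split=> //.
    by rewrite /shift big_nil scale1r sub0r.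
  by rewrite /cost big_nil mul1r sub0r.
apply/frechet_normalP; split=> // e e0.
have [n ne] : exists n : nat, n.+1%:R^-1 < e.
  by have [n _ /(_ n (leqnn n))] := near_infty_natSinv_lt (PosNum e0); exists n.
exists (1 / 2 * (k n).+1%:R^-1); first by rewrite mulr_gt0// invr_gt0.
move=> u Su uz; apply: (@le_trans _ _ (`|u - z| * n.+1%:R^-1)); last first.
  by rewrite mulrC ler_wpM2r// ltW.
apply: zG; exists [:: (1, (n, k n), u)], 0; split=> //.
- by split=> x; rewrite inE => /eqP->.
- by rewrite /shift big_seq1 scale0r subr0 scale1r.
- by rewrite /cost big_seq1 mul0r subr0 mul1r.
Qed.

End one_point.

(** The set [D] contains witnesses for all lists of keys, so it can be fixed before [z], [zeta] and
    the radii [k] belonging to [zeta] are known. *)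
Lemma separable_reduction (z0 : Z) : asp Z ->
  exists U : set Z, [/\ closed U, U z0, sepdual U,
    forall u v, U u -> U v -> U (u - v) &
    forall z zeta, frechet_normal (S `&` U) z zeta ->
      (forall v, zeta v <= tau v) -> `|E z| / 2 <= zeta (E z) ->
      exists zeta' : dual Z, [/\ frechet_normal S z zeta',
        forall v, zeta' v <= tau v & `|E z| / 2 <= zeta' (E z)]].
Proof.
move=> aZ; have [D [Dz0 Dc Dop]] := countable_op_closure op (countable1 z0).
have Dr : rat_closed D by move=> p q u v; exact: (Dop (inr (p, q))).
exists (closure D); split.
- exact: closed_closure.
- by apply: subset_closure; exact: Dz0.
- by apply: sepdual_closure; exact: aZ.
- by move=> u v; exact: closureB.
move=> z zeta zN zt zE; have /frechet_normalP[[Sz Dz] zP] := zN.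
have kex n : exists k : nat, forall u, (S `&` closure D) u ->
    `|u - z| < k.+1%:R^-1 -> zeta (u - z) <= `|u - z| * n.+1%:R^-1.
  have n0 : 0 < n.+1%:R^-1 :> R by rewrite invr_gt0.
  have [d d0 dP] := zP _ n0.
  have [k _ /(_ k (leqnn k)) kd] := near_infty_natSinv_lt (PosNum d0).
  exists k => u uSD uk; rewrite mulrC; apply: dP => //.
  by apply: lt_trans uk _; exact: kd.
have [k kP] := choice kex.
exact: (lift_normal Dop Sz Dz zt zE kP).
Qed.

End separable_reduction.

(** * Operations on tame functions *)

Section tame_operations.
Context (R : realType) (Z : normedModType R).
Implicit Types (tau : Z -> R) (D : set Z).

(** Taking [D] empty asks for no differentiability; this is how nonsmooth convex functions enter the
    variational principle. *)
Lemma tame_sublinear tau (K : R) : sublinear tau ->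
  (forall x, tau x <= K * `|x|) -> tame set0 tau tau.
Proof.
move=> ts tK x; have [g [gt gx]] := sublinear_support x ts tK.
exists g; split=> // [y|e _]; last by exists 1.
by rewrite dual_evalB -gx addrC subrK.
Qed.

Lemma tameD D tau1 tau2 P1 P2 : tame D tau1 P1 -> tame D tau2 P2 ->
  tame D (fun v => tau1 v + tau2 v) (fun x => P1 x + P2 x).
Proof.
move=> t1 t2 x; have [g1 [gt1 gP1 gd1]] := t1 x.
have [g2 [gt2 gP2 gd2]] := t2 x; exists (g1 + g2); split=> [v|y|e e0].
- by rewrite dualD lerD.
- by rewrite dualD; have := gP1 y; have := gP2 y; lra.
have e20 : 0 < e / 2 by rewrite divr_gt0.
have [d1 d10 dP1] := gd1 _ e20; have [d2 d20 dP2] := gd2 _ e20.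
exists (Num.min d1 d2); first by rewrite lt_min d10.
move=> y Dy; rewrite lt_min => /andP[/(dP1 y Dy) y1 /(dP2 y Dy) y2].
by rewrite dualD; lra.
Qed.

Lemma tameZ D tau P (m : R) : 0 < m -> tame D tau P ->
  tame D (fun v => m * tau v) (fun x => m * P x).
Proof.
move=> m0 t x; have [g [gt gP gd]] := t x; exists (m *: g).
split=> [v|y|e e0]; rewrite ?dualZ.
- by rewrite ler_pM2l.
- by rewrite -mulrDr ler_pM2l.
have em : 0 < e / m by rewrite divr_gt0.
have [d d0 dP] := gd _ em; exists d => // y Dy yd; rewrite dualZ.
have := dP y Dy yd; rewrite -(ler_pM2l m0) !mulrDr.
by have -> : m * (e / m * `|y - x|) = e * `|y - x| by field; rewrite gt_eqF.
Qed.

Lemma tame_shift D tau P (c : Z) : tame D tau P ->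
  tame D tau (fun x => P (x - c)).
Proof.
move=> t x; have [g [gt gP gd]] := t (x - c); exists g.
have sub y : y - c - (x - c) = y - x by rewrite opprB addrA subrK.
split=> [//|y|e e0]; first by have := gP (y - c); rewrite sub.
have [d d0 dP] := gd _ e0; exists d => // y Dy yd.
by have := dP (y - c); rewrite sub; exact.
Qed.

Lemma tame_convex D tau P (t : R) a b : tame D tau P -> 0 <= t -> t <= 1 ->
  P ((1 - t) *: a + t *: b) <= (1 - t) * P a + t * P b.
Proof.
move=> tP t0 t1; set p := _ + _; have [g [_ gP _]] := tP p.
have t1' : 0 <= 1 - t by rewrite subr_ge0.
have := ler_wpM2l t1' (gP a); have := ler_wpM2l t0 (gP b).
have : (1 - t) * g (a - p) + t * g (b - p) = 0.
  rewrite !dual_evalB /p dual_evalD !dual_evalZ; ring.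
by lra.
Qed.

Lemma sublinear_norm : sublinear (fun v : Z => `|v|).
Proof.
split=> [x y|c x c0]; first exact: ler_normD.
by rewrite normrZ gtr0_norm.
Qed.

End tame_operations.

(** * Clarke normals at constrained minimisers of convex functions *)

Section clarke.
Context (R : realType) (Z : normedModType R).
Implicit Types (S : set Z).

Lemma clarke_tangent0 S z : clarke_tangent S z 0.
Proof.
move=> zk t Szk _ _ _; exists (fun=> 0); first exact: cvg_cst.
by move=> k; rewrite scaler0 addr0.
Qed.

(** The tangency of [w] is used along [zk + t k *: vk], a sequence of points of [S] that still tends
    to [z]. *)
Lemma clarke_tangentD S z v w : clarke_tangent S z v -> clarke_tangent S z w ->
  clarke_tangent S z (v + w).
Proof.
move=> Tv Tw zk t Szk zkz t0 t_0.
have [vk vkv Svk] := Tv zk t Szk zkz t0 t_0.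
have [|wk wkw Swk] := Tw _ t Svk _ t0 t_0.
  rewrite -[z]addr0 -(scale0r v); apply: cvgD => //.
  exact: cvgZ.
exists (fun k => vk k + wk k); first exact: cvgD.
by move=> k; rewrite scalerDr addrA.
Qed.

Lemma clarke_tangentZ S z (c : R) v : 0 < c -> clarke_tangent S z v ->
  clarke_tangent S z (c *: v).
Proof.
move=> c0 Tv zk t Szk zkz t0 t_0.
have [||vk vkv Svk] := Tv zk (fun k => c * t k) Szk zkz.
- by move=> k; rewrite mulr_gt0.
- by rewrite -(mulr0 c); apply: cvgM => //; exact: cvg_cst.
exists (fun k => c *: vk k); first by apply: cvgZ => //; exact: cvg_cst.
by move=> k; rewrite scalerA mulrC.
Qed.

(** Along the constant sequence [z], minimality compares [F z] with values close to
    [F (z + t k *: w)]; convexity extends the comparison from the short steps [t k] to the full step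
    [w]. *)
Lemma min_clarke_tangent S z tau (C : R) F w : S z ->
  tame set0 tau F -> (forall v, tau v <= C * `|v|) ->
  (forall y, S y -> F z <= F y) -> clarke_tangent S z w -> F z <= F (z + w).
Proof.
move=> Sz tF tC zmin Tw.
pose t (k : nat) : R := k.+1%:R^-1.
have t0 k : 0 < t k by rewrite invr_gt0.
have t1 k : t k <= 1 by rewrite invf_le1// ler1n.
have t_0 : t @ \oo --> (0 : R) by exact: cvg_harmonic.
have [wk wkw Swk] := Tw (fun=> z) t (fun=> Sz) (cvg_cst z) t0 t_0.
apply/ler_addgt0Pr => e e0.
have C0 : 0 < `|C| + 1 by rewrite ltr_wpDl.
have /cvgrPdist_lt/(_ _ (divr_gt0 e0 C0))[n _ /(_ n (leqnn n))] := wkw.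
rewrite /= ltr_pdivlMr// => wn.
have conv := tame_convex z (z + w) tF (ltW (t0 n)) (t1 n).
have cE : (1 - t n) *: z + t n *: (z + w) = z + t n *: w.
  by rewrite scalerBl scale1r scalerDr addrA subrK.
rewrite cE in conv.
have lip := tame_lipschitz (z + t n *: w) (z + t n *: wk n) tF.
have dE : z + t n *: wk n - (z + t n *: w) = t n *: (wk n - w).
  by rewrite scalerBr opprD addrACA subrr add0r.
rewrite dE in lip.
have := tC (t n *: (wk n - w)); rewrite normrZ (gtr0_norm (t0 n)).
have : C * (t n * `|wk n - w|) <= t n * e.
  rewrite mulrCA ler_pM2l// distrC; apply: le_trans (ltW wn).
  by rewrite mulrC ler_wpM2l//; have := ler_norm C; lra.
have := zmin _ (Swk n) => mn q1 q2.
have : t n * F z <= t n * (F (z + w) + e) by rewrite mulrDr; lra.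
by rewrite ler_pM2l.
Qed.

(** [sandwich] is applied to the constraints [zeta (w - t *: v) <= t * (F (z + v) - F z)] with [w]
    tangent, which combine normality with the subgradient inequality. They are compatible with the
    norm since [F z <= F (z + t^-1 *: w)] and [F] is Lipschitz. *)
Lemma clarke_min S z tau (C : R) F : S z ->
  tame set0 tau F -> (forall v, tau v <= C * `|v|) ->
  (forall y, S y -> F z <= F y) ->
  exists zeta : dual Z, clarke_normal S z zeta /\
    forall v, - zeta v <= F (z + v) - F z.
Proof.
move=> Sz tF tC zmin; set T := clarke_tangent S z.
pose G (u : Z) (r : R) := exists w v t, [/\ T w, 0 < t, u = w - t *: v &
  t * (F (z + v) - F z) <= r].
have snorm : sublinear (fun v : Z => `|C| * `|v|).
  have [sD sZ] := sublinear_norm Z; split=> [x y|c x c0].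
    by rewrite -mulrDr ler_wpM2l.
  by rewrite mulrCA ler_wpM2l// sZ.
have [|u1 r1 u2 r2 [w1 [v1 [t1 [Tw1 t10 -> r1P]]]]
      [w2 [v2 [t2 [Tw2 t20 -> r2P]]]]|
    c _ r c0 [w [v [t [Tw t0 -> rP]]]]|_ r [w [v [t [Tw t0 -> rP]]]]|
    zeta [_ zG]] := @sandwich R Z (fun v => `|C| * `|v|) `|C| G snorm (fun=> lexx _).
- exists 0, 0, 1; split=> //; first exact: clarke_tangent0.
    by rewrite scaler0 subr0.
  by rewrite addr0 subrr mulr0.
- have t0 : 0 < t1 + t2 by rewrite addr_gt0.
  (* The weight that merges the two test points into a convex combination carrying the factor
     [t1 + t2]. *)
  pose s := t2 / (t1 + t2).
  have s0 : 0 <= s by rewrite divr_ge0// ltW.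
  have s1 : s <= 1 by rewrite ler_pdivrMr// mul1r lerDr ltW.
  have st2 : (t1 + t2) * s = t2 by rewrite mulrC divfK// gt_eqF.
  have st1 : (t1 + t2) * (1 - s) = t1 by rewrite mulrBr mulr1 st2 addrK.
  exists (w1 + w2), ((1 - s) *: v1 + s *: v2), (t1 + t2); split=> //.
  + exact: clarke_tangentD.
  + by rewrite scalerDr !scalerA st1 st2 opprD addrACA.
  have := tame_convex (z + v1) (z + v2) tF s0 s1.
  have -> : (1 - s) *: (z + v1) + s *: (z + v2) =
      z + ((1 - s) *: v1 + s *: v2).
    by rewrite !scalerDr addrACA -scalerDl subrK scale1r.
  move=> /(ler_wpM2l (ltW t0)); rewrite mulrDr mulrA st1 mulrA st2.
  by move: r1P r2P; rewrite !mulrBr mulrDl; lra.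
- exists (c *: w), v, (c * t); split; first exact: clarke_tangentZ.
  + by rewrite mulr_gt0.
  + by rewrite scalerBr scalerA.
  + by rewrite -mulrA ler_pM2l.
- rewrite normrN; apply: le_trans (lerD rP (lexx _)).
  have ti0 : 0 < t^-1 by rewrite invr_gt0.
  have := min_clarke_tangent Sz tF tC zmin (clarke_tangentZ ti0 Tw).
  have := tame_lipschitz (z + v) (z + t^-1 *: w) tF.
  rewrite opprD addrACA subrr add0r.
  have := tC (t^-1 *: w - v).
  have : C * `|t^-1 *: w - v| <= `|C| * `|t^-1 *: w - v|.
    by rewrite ler_wpM2r// ler_norm.
  have -> : `|w - t *: v| = t * `|t^-1 *: w - v|.
    rewrite -{2}(gtr0_norm t0) -normrZ scalerBr scalerA divff ?gt_eqF//.
    by rewrite scale1r.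
  rewrite mulrCA -mulrDr => q1 q2 q3 q4.
  by rewrite mulr_ge0//; [exact: ltW|lra].
exists zeta; split=> [|v].
  split=> // w Tw; apply: zG; exists w, 0, 1; split=> //.
    by rewrite scaler0 subr0.
  by rewrite addr0 subrr mulr0.
rewrite -dual_evalN; apply: zG; exists 0, v, 1; split=> //.
- exact: clarke_tangent0.
- by rewrite scale1r sub0r.
- by rewrite mul1r.
Qed.

End clarke.

(** * Normals to product sets *)

Section product_sets.
Context (R : realType) (X Y : normedModType R).
Implicit Types (A : set X) (B : set Y).

Definition prod_set A B : set (X * Y) := [set p | A p.1 /\ B p.2].

Lemma closed_prod_set A B : closed A -> closed B -> closed (prod_set A B).
Proof.
move=> cA cB p pAB; split; [apply: cA|apply: cB]; apply: approx_closure => e e0;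
  have [q [qA qB]] := closure_approx pAB e0;
  rewrite prod_normE gt_max => /andP[q1 q2].
  by exists q.1.
by exists q.2.
Qed.

(** A tangent vector to one factor, completed by 0, is tangent to the product. *)
Lemma clarke_normal_prod A B (p : X * Y) (zeta : dual (X * Y)%type)
    (alpha : dual X) (beta : dual Y) :
  (forall w, alpha w = zeta (w, 0)) -> (forall w, beta w = zeta (0, w)) ->
  clarke_normal (prod_set A B) p zeta ->
  clarke_normal A p.1 alpha /\ clarke_normal B p.2 beta.
Proof.
case: p => a b aE bE [[/= Aa Bb] zN].
have cvgp (F : nat -> X * Y) (l : X * Y) : (fun k => (F k).1) @ \oo --> l.1 ->
    (fun k => (F k).2) @ \oo --> l.2 -> F @ \oo --> l.
  move=> h1 h2; rewrite (_ : F = (fun k => ((F k).1, (F k).2))); last first.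
    by apply/funext => k; case: (F k).
  by case: l h1 h2 => l1 l2 /= h1 h2; exact: cvg_pair.
have fst_cvg (F : nat -> X * Y) (l : X * Y) : F @ \oo --> l -> (fun k => (F k).1) @ \oo --> l.1.
  case: l => a' b' Fl; apply: (@cvg_comp _ _ _ F fst \oo (nbhs (a', b')) (nbhs a') Fl).
  exact: cvg_fst.
have snd_cvg (F : nat -> X * Y) (l : X * Y) : F @ \oo --> l -> (fun k => (F k).2) @ \oo --> l.2.
  case: l => a' b' Fl; apply: (@cvg_comp _ _ _ F snd \oo (nbhs (a', b')) (nbhs b') Fl).
  exact: cvg_snd.
split; split=> // w Tw; rewrite ?aE ?bE; apply: zN => zk t Sz zc t0 tc.
- have [wk wc Swk] := Tw (fun k => (zk k).1) t (fun k => (Sz k).1) (fst_cvg _ _ zc) t0 tc.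
  exists (fun k => (wk k, 0)); first by apply: cvgp => //=; exact: cvg_cst.
  by move=> k; split=> /=; [exact: Swk|rewrite scaler0 addr0; case: (Sz k)].
- have [wk wc Swk] := Tw (fun k => (zk k).2) t (fun k => (Sz k).2) (snd_cvg _ _ zc) t0 tc.
  exists (fun k => (0, wk k)); first by apply: cvgp => //=; exact: cvg_cst.
  by move=> k; split=> /=; [rewrite scaler0 addr0; case: (Sz k)|exact: Swk].
Qed.

Lemma frechet_normal_prod A B (p : X * Y) (zeta : dual (X * Y)%type)
    (alpha : dual X) (beta : dual Y) :
  (forall w, alpha w = zeta (w, 0)) -> (forall w, beta w = zeta (0, w)) ->
  frechet_normal (prod_set A B) p zeta ->
  frechet_normal A p.1 alpha /\ frechet_normal B p.2 beta.
Proof.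
case: p => a b aE bE /frechet_normalP[[/= Aa Bb] zN].
split; apply/frechet_normalP; split=> // e /zN[d d0 dP]; exists d => // u Su ud.
- have := dP (u, b) (conj Su Bb).
  have -> : (u, b) - (a, b) = (u - a, 0) :> X * Y.
    by apply: injective_projections; rewrite /= ?subrr.
  by rewrite prod_normE/= normr0 (max_l (normr_ge0 _)) aE; exact.
- have := dP (a, u) (conj Aa Su).
  have -> : (a, u) - (a, b) = (0, u - b) :> X * Y.
    by apply: injective_projections; rewrite /= ?subrr.
  by rewrite prod_normE/= normr0 (max_r (normr_ge0 _)) bE; exact.
Qed.

End product_sets.

(** * Extremal principles for two closed sets *)

Section separation.
Context (R : realType) (W : normedModType R).
Implicit Types (A B : set W).

Definition nearly_separated (N : normal_cone R) A B a0 b0 (m r : R) :=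
  exists a b (alpha beta : dual W),
    [/\ `|a - a0| <= r, `|b - b0| <= r, N W A a alpha & N W B b beta] /\
    [/\ `|alpha + beta| <= m, 2^-1 <= `|alpha|, `|alpha| <= 2 & `|beta| <= 2].

Definition gap (p : W * W) : R := `|p.1 - p.2|.

(** Adding this vector moves the first point onto the second and closes the gap; it serves as the
    map [E] in the separable reduction. *)
Definition gapdir (p : W * W) : W * W := (p.2 - p.1, 0).

Lemma gapdir_norm p : `|gapdir p| = gap p.
Proof. by rewrite prod_normE/= normr0 max_l// distrC. Qed.

Lemma gap_le p : gap p <= 2 * `|p|.
Proof.
apply: le_trans (ler_normB _ _) _; rewrite prod_normE.
have : `|p.1| <= Num.max `|p.1| `|p.2| by rewrite le_max lexx.
have : `|p.2| <= Num.max `|p.1| `|p.2| by rewrite le_max lexx orbT.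
lra.
Qed.

Lemma gap_sublinear : sublinear gap.
Proof.
split=> [x y|c x c0]; rewrite /gap /=.
  by rewrite opprD addrACA ler_normD.
by rewrite -scalerBr normrZ gtr0_norm.
Qed.

Lemma gap_lip p q : gap p - gap q <= gap (p - q).
Proof. by have := gap_sublinear.1 (p - q) q; rewrite subrK; lra. Qed.

Lemma gapN p : gap (- p) = gap p.
Proof. by rewrite /gap/= -opprD normrN. Qed.

(** The gap vanishes on the diagonal, where [zeta] acts as [alpha + beta], whence the bound [m]; the
    value of [zeta] at [gapdir p] is a value of [alpha] alone and keeps its norm at least 1/2. *)
Lemma nearly_separated_of_functional (N : normal_cone R) A B a0 b0 (m r : R) p
    (zeta : dual (W * W)%type) : 0 <= m -> m <= 1 ->
  (forall (q : W * W) (xi : dual (W * W)%type) (alpha beta : dual W),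
    (forall w, alpha w = xi (w, 0)) -> (forall w, beta w = xi (0, w)) ->
    N (W * W)%type (prod_set A B) q xi -> N W A q.1 alpha /\ N W B q.2 beta) ->
  N (W * W)%type (prod_set A B) p zeta ->
  (forall v, zeta v <= gap v + m * `|v|) -> `|gapdir p| / 2 <= zeta (gapdir p) ->
  0 < gap p -> `|p - (a0, b0)| <= r -> nearly_separated N A B a0 b0 m r.
Proof.
move=> m0 m1 Nprod Np zle zp gp; rewrite prod_normE ge_max => /andP[pa pb].
have [alpha [beta [aE bE zE]]] := dual_components zeta.
have zabs v : `|zeta v| <= gap v + m * `|v|.
  rewrite ler_norml zle andbT lerNl -dual_evalN.
  by have := zle (- v); rewrite gapN normrN.
have [Na Nb] := Nprod p zeta alpha beta aE bE Np.
exists p.1, p.2, alpha, beta; split; split=> //.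
- apply: dual_norm_le => w w1.
  have -> : (alpha + beta) w = zeta (w, w) :> R.
    by rewrite dualD zE.
  have := zabs (w, w); rewrite /gap/= subrr normr0 add0r prod_normE/= maxxx.
  move=> /le_trans; apply.
  by rewrite ler_piMr.
- have := dual_normP alpha (p.2 - p.1).
  have := ler_norm (alpha (p.2 - p.1)).
  move: zp; rewrite gapdir_norm -aE /gap [`|p.2 - _|]distrC.
  move: gp; rewrite /gap => gp q1 q2 q3.
  have : 2^-1 * `|p.1 - p.2| <= `|alpha| * `|p.1 - p.2|.
    by change `|alpha| with (dual_norm alpha); lra.
  by rewrite ler_pM2r.
- apply: dual_norm_le => w w1; rewrite aE.
  apply: le_trans (zabs _) _; rewrite /gap/= subr0 prod_normE/= normr0.
  rewrite (max_l (normr_ge0 w)); have := normr_ge0 w; nra.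
- apply: dual_norm_le => w w1; rewrite bE.
  apply: le_trans (zabs _) _; rewrite /gap/= sub0r normrN prod_normE/= normr0.
  rewrite (max_r (normr_ge0 w)); have := normr_ge0 w; nra.
Qed.

End separation.

Section extremal_principles.
Context (R : realType) (W : normedModType R).
Implicit Types (A B : set W).

Let Z := (W * W)%type.

Lemma gap_shift (p : Z) : gap (p + gapdir p) = 0.
Proof. by rewrite /gap/= addr0 addrCA subrr addr0 subrr normr0. Qed.

Lemma tame_gap : tame set0 (@gap R W) (@gap R W).
Proof. exact: tame_sublinear (gap_sublinear W) (@gap_le R W). Qed.

Lemma norm_perturbation (sigma : R) : 0 < sigma ->
  exists P, tame set0 (fun v : Z => `|v|) P /\
    forall x, `|x| <= P x <= `|x| + sigma.
Proof.
move=> s0; exists (fun x => `|x|); split.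
  by apply: (tame_sublinear (K := 1)) => [|x]; [exact: sublinear_norm|rewrite mul1r].
by move=> x; rewrite lexx lerDl ltW.
Qed.

Lemma gap_lipschitz (p q : Z) : gap p - gap q <= 2 * `|p - q|.
Proof. exact: le_trans (gap_lip _ _) (gap_le _). Qed.

Lemma gap_m_le (m : R) (v : Z) : gap v + m * `|v| <= (2 + m) * `|v|.
Proof. by rewrite mulrDl lerD2r gap_le. Qed.

Lemma gap_m_sublinear (m : R) : 0 <= m ->
  sublinear (fun v : Z => gap v + m * `|v|).
Proof.
move=> m0; have [gD gZ] := gap_sublinear W.
have [nD nZ] := sublinear_norm Z; split=> [x y|c x c0].
  have := gD x y; have := ler_wpM2l m0 (nD x y); rewrite mulrDr; lra.
have := gZ c x c0; have := ler_wpM2l m0 (nZ c x c0); rewrite mulrDr mulrCA; lra.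
Qed.

(** At a minimiser [p] of the perturbed gap the gap is positive by disjointness. Moving by
    [gapdir p] removes the gap while the perturbation grows by at most a quarter of it, so the
    normal is large in this direction. *)
Lemma clarke_separation A B a0 b0 (m r : R) :
  geo_complete W -> closed A -> closed B -> A a0 -> B b0 ->
  0 < m -> m <= 4^-1 -> 0 < r -> r <= 1 -> `|a0 - b0| <= m * r / 16 ->
  (forall a, A a -> B a -> `|a - a0| <= r -> `|a - b0| <= r -> False) ->
  nearly_separated (@clarke_normal R) A B a0 b0 m r.
Proof.
move=> Wc cA cB Aa Bb m0 m4 r0 r1 ab disj.
have Zc := geo_complete_prod Wc Wc.
have cS := closed_prod_set cA cB.
have [||p [D [Sp pr tD pmin]]] := @variational_principle R Z (prod_set A B) set0
  (@gap R W) (a0, b0) 2 m r Zc cS (conj Aa Bb) gap_lipschitz m0 r0 r1.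
- by move=> y _; rewrite /gap/=; have := normr_ge0 (y.1 - y.2); lra.
- exact: norm_perturbation.
have tF := tameD tame_gap tD.
have gp : 0 < gap p.
  rewrite lt_def normr_ge0 andbT; apply/negP; rewrite normr_eq0 subr_eq0 => /eqP p12.
  move: pr; rewrite prod_normE ge_max /= => /andP[pa pb].
  by case: Sp => Ap Bp; apply: (disj p.1) => //; rewrite p12.
have [zeta [zN zF]] := clarke_min Sp tF (gap_m_le m) pmin.
have zle v : zeta v <= gap v + m * `|v|.
  rewrite -[v in zeta v]opprK dual_evalN; apply: le_trans (zF (- v)) _.
  apply: le_trans (tame_lipschitz p (p - v) tF) _.
  by rewrite addrAC subrr add0r gapN normrN.
have zp : `|gapdir p| / 2 <= zeta (gapdir p).
  have := zF (gapdir p); rewrite gap_shift.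
  have := tame_lipschitz p (p + gapdir p) tD.
  rewrite [p + _ - p]addrAC subrr add0r gapdir_norm => q1 q2.
  have : m * gap p <= 4^-1 * gap p by rewrite ler_pM2r.
  lra.
apply: (nearly_separated_of_functional (ltW m0) _ _ zN zle zp gp pr).
  lra.
exact: clarke_normal_prod.
Qed.

(** Two minimisations on the trace of the product: the first, with perturbations by norms, fixes a
    positive gap; the second, with smooth functions, takes place close to the first minimiser and
    supplies a Frechet normal to the trace, which is then lifted. *)
Lemma frechet_separation A B a0 b0 (m r : R) : asp W ->
  geo_complete W -> closed A -> closed B -> A a0 -> B b0 ->
  0 < m -> m <= 4^-1 -> 0 < r -> r <= 1 -> `|a0 - b0| <= m * r / 64 ->
  (forall a, A a -> B a -> `|a - a0| <= r -> `|a - b0| <= r -> False) ->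
  nearly_separated (@frechet_normal R) A B a0 b0 m r.
Proof.
move=> aW Wc cA cB Aa Bb m0 m4 r0 r1 ab disj.
have Zc := geo_complete_prod Wc Wc.
have E_lip (p q : Z) : `|gapdir p - gapdir q| <= 2 * `|p - q|.
  have -> : gapdir p - gapdir q = gapdir (p - q).
    apply: injective_projections; rewrite /= ?subrr//.
    by rewrite !opprD !opprK addrACA.
  by rewrite gapdir_norm gap_le.
have K0 : 0 <= 2 + m by rewrite addr_ge0// ltW.
have [U [cU Uz0 sU UB lift]] := @separable_reduction R Z (prod_set A B)
  (fun v => gap v + m * `|v|) (2 + m) (@gapdir R W) (gap_m_sublinear (ltW m0)) K0
  (gap_m_le m) E_lip (a0, b0) (asp_prod aW aW).
have cS : closed (prod_set A B `&` U).
  by apply: closedI => //; exact: closed_prod_set.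
(* The slope [m] is shared equally between the perturbations of the two minimisations. *)
pose m1 := m / 2; have m10 : 0 < m1 by rewrite divr_gt0.
have r20 : 0 < r / 2 by rewrite divr_gt0.
have r21 : r / 2 <= 1 by lra.
have Sz0 : (prod_set A B `&` U) (a0, b0) by split.
have [||p1 [D1 [[Sp1 Up1] pr1 tD1 pmin1]]] := @variational_principle R Z
  (prod_set A B `&` U) set0 (@gap R W) (a0, b0) 2 m1 (r / 2) Zc cS Sz0
  gap_lipschitz m10 r20 r21.
- move=> y _; rewrite /gap/= /m1; have := normr_ge0 (y.1 - y.2); lra.
- exact: norm_perturbation.
have disjZ p : prod_set A B p -> `|p - (a0, b0)| <= r -> 0 < gap p.
  move=> [Ap Bp]; rewrite prod_normE ge_max /= => /andP[pa pb].
  rewrite lt_def normr_ge0 andbT; apply/negP; rewrite normr_eq0 subr_eq0 => /eqP p12.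
  by apply: (disj p.1) => //; rewrite p12.
(* The norm of the gap need not be smooth: it is replaced by a smooth
   approximation whose error is negligible compared with the gap th at p1. *)
set th := gap p1; have th0 : 0 < th by apply: disjZ => //; lra.
have ek y : (prod_set A B `&` U) y -> th <= gap y + m1 * `|y - p1|.
  move=> Sy; have := pmin1 y Sy; have := tame_lipschitz p1 y tD1; rewrite /th; lra.
(* The gap is 2-Lipschitz, so within [th / 8] of [p1] it stays above [3 / 4 * th]. *)
pose r2 := Num.min (r / 2) (th / 8).
have r20' : 0 < r2 by rewrite lt_min r20 divr_gt0.
have r2r : r2 <= r / 2 by rewrite ge_min lexx.
have r2th : r2 <= th / 8 by rewrite ge_min lexx orbT.
(* The two smoothings raise [phi p1] by at most [2 * sig], so the first bound gives the initial
   accuracy [m1 * r2 / 16]; the second keeps the error small against the gap. *)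
pose sig := Num.min (m1 * r2 / 32) (th / 8).
have sig0 : 0 < sig by rewrite lt_min !divr_gt0// mulr_gt0.
have sigr : sig <= m1 * r2 / 32 by rewrite ge_min lexx.
have sigth : sig <= th / 8 by rewrite ge_min lexx orbT.
have n1 (x : Z) : `|x| <= 1 * `|x| by rewrite mul1r.
have [P [tP Pb]] := smooth_approx (gap_sublinear W) (@gap_le R W) sU sig0.
have [Q [tQ Qb]] := smooth_approx (sublinear_norm Z) n1 sU sig0.
have tQ' := tameZ m10 (tame_shift p1 tQ).
pose phi x := P x + m1 * Q (x - p1).
have tphi : tame U (fun v => gap v + m1 * `|v|) phi := tameD tP tQ'.
have [||||p [D2 [[Sp Up] pr2 tD2 pmin2]]] := @variational_principle R Z
  (prod_set A B `&` U) U phi p1 (2 + m1) m1 r2 Zc cS (conj Sp1 Up1) _ m10 r20' _.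
- move=> x y. apply: le_trans (tame_lipschitz y x tphi) _; exact: gap_m_le.
- lra.
- move=> y Sy; have := ek y Sy; rewrite /phi subrr.
  have /andP[_] := Pb p1; have /andP[_] := Qb 0; rewrite normr0 add0r -/th.
  move=> /(ler_wpM2l (ltW m10)).
  have /andP[+ _] := Pb y; have /andP[+ _] := Qb (y - p1).
  move=> /(ler_wpM2l (ltW m10)).
  have : m1 * sig <= sig by rewrite ler_piMl// ?ltW// /m1; lra.
  lra.
- by move=> s s0; exact: smooth_approx (sublinear_norm Z) n1 sU s0.
have tF := tameD tphi tD2.
have [g [gt gF gd]] := tF p.
have mE (x : R) : m1 * x + m1 * x = m * x by rewrite -mulrDl /m1; congr (_ * _); lra.
have gp : 3 / 4 * th <= gap p.
  have := gap_lipschitz p1 p; rewrite distrC -/th; lra.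
have Fgap : phi p + D2 p - (phi (p + gapdir p) + D2 (p + gapdir p)) >=
    gap p - sig - m * gap p.
  have := tame_lipschitz p (p + gapdir p) tD2.
  have := tame_lipschitz p (p + gapdir p) tQ'.
  have /andP[_] := Pb (p + gapdir p); rewrite gap_shift add0r.
  have /andP[+ _] := Pb p.
  rewrite [p + _ - p]addrAC subrr add0r gapdir_norm -(mE (gap p)) /phi.
  lra.
have [zeta [zN zle zp]] : exists zeta : dual Z,
    [/\ frechet_normal (prod_set A B) p zeta,
      forall v, zeta v <= gap v + m * `|v| & `|gapdir p| / 2 <= zeta (gapdir p)].
  (* At a minimiser over the trace, minus the derivative is a Frechet normal: differentiability
     along [U] is enough, as differences of points of [U] lie in [U]. *)
  apply: (lift p (- g)) => [|v|].
  - apply/frechet_normalP; split=> // e /gd[d d0 dP]; exists d => // y [Sy Uy] yp.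
    have := dP y (UB _ _ Uy Up) yp; have := pmin2 y (conj Sy Uy).
    by rewrite dualN; lra.
  - rewrite dualN -dual_evalN; apply: le_trans (gt (- v)) _.
    by rewrite gapN normrN -addrA mE.
  - rewrite dualN gapdir_norm; have := gF (p + gapdir p).
    rewrite [p + _ - p]addrAC subrr add0r.
    have : m * gap p <= 4^-1 * gap p by rewrite ler_pM2r//; lra.
    lra.
apply: (nearly_separated_of_functional (ltW m0) _ _ zN zle zp) => //.
- lra.
- exact: frechet_normal_prod.
- lra.
- by apply: le_trans (ler_distD p1 _ _) _; lra.
Qed.

End extremal_principles.

(** * Consequences of (O1) and of extremality; scaling of normals *)

Section multipliers.
Context (R : realType).

Lemma O1_approx (Y : normedModType R) (L : Y -> set Y) ybar (eta : R) :
  O1 L ybar -> 0 < eta -> exists y v,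
    [/\ Lcirc L ybar y, `|y - ybar| < eta, L y v & `|v - ybar| < eta].
Proof.
move=> /(congr1 (fun x => - x)%E); rewrite oppeK oppe0 => L0 eta0.
pose V := [set y | Lcirc L ybar y /\ `|y - ybar| < eta].
have VF : within (Lcirc L ybar) (nbhs ybar) V.
  apply/nbhs_ballP; exists eta => // u; rewrite -ball_normE/= distrC => ue Lu.
  by split.
have : ((- eta)%:E < ereal_sup [set (- set_dist ybar (L u))%E | u in V])%E.
  apply: (@lt_le_trans _ _ 0%E); first by rewrite lte_fin oppr_lt0.
  by rewrite -L0; apply: ge_ereal_inf; eexists; [exists V => //|].
move=> /ereal_sup_gt[_ [y [Ly ye] <-]].
rewrite EFinN lteN2 => /ereal_inf_lt[_ [v Lv <-]]; rewrite lte_fin => ve.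
by exists y, v.
Qed.

Lemma extremal_radius (X Y : normedModType R) (L : Y -> set Y) (F : X -> set Y)
    (Omega : set X) xbar ybar : extremal L F Omega xbar ybar ->
  exists2 rho : R, 0 < rho & forall x y, Omega x -> F x y ->
    `|x - xbar| < rho -> `|y - ybar| < rho -> ~ Lcirc L ybar y.
Proof.
move=> [rho rho0 disj].
have [s s0 srho] : exists2 s : R, 0 < s & (s%:E <= rho)%E.
  case: rho rho0 {disj} => [s|_|//]; first by rewrite lte_fin => s0; exists s.
  by exists 1 => //; rewrite leey.
exists s => // x y Ox Fxy xs ys Ly.
suff : set0 y by [].
rewrite -disj; split; [split=> //|].
- exists x => //; split=> //; rewrite /oball/=.
  by apply: lt_le_trans srho; rewrite lte_fin.
- by rewrite /oball/=; apply: lt_le_trans srho; rewrite lte_fin.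
Qed.

Lemma clarke_normalZ (Z : normedModType R) (S : set Z) z zs (c : R) : 0 < c ->
  clarke_normal S z zs -> clarke_normal S z (c *: zs).
Proof.
move=> c0 [Sz zN]; split=> // w /zN zw; rewrite dualZ.
by rewrite mulr_ge0_le0// ltW.
Qed.

Lemma frechet_normalZ (Z : normedModType R) (S : set Z) z zs (c : R) : 0 < c ->
  frechet_normal S z zs -> frechet_normal S z (c *: zs).
Proof.
move=> c0 /frechet_normalP[Sz zN]; apply/frechet_normalP; split=> // e e0.
have [d d0 dP] := zN _ (divr_gt0 e0 c0); exists d => // u Su ud.
have := dP u Su ud; rewrite dualZ -(ler_pM2l c0) mulrA.
by have -> : c * (e / c) = e by rewrite mulrC divfK// gt_eqF.
Qed.

Lemma dual_ball (Z : normedModType R) (f : dual Z) (e : R) :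
  `|f| < e -> ball (0 : dual Z) e f.
Proof. by rewrite -ball_normE/= sub0r normrN. Qed.

(** * The multiplier rule for any normal cone with an extremal principle *)

Section rule.
Context (N : normal_cone R) (X Y : normedModType R).
Context (Omega : set X) (F : X -> set Y) (L : Y -> set Y).
Context (xbar : X) (ybar : Y) (delta : R).
Hypothesis normal_mem : forall (Z : normedModType R) (S : set Z) z zs,
  N S z zs -> S z.
Hypothesis normalZ : forall (Z : normedModType R) (S : set Z) z zs (c : R),
  0 < c -> N S z zs -> N S z (c *: zs).
Hypothesis normal_prod : forall (A : set X) (B : set Y) (p : X * Y)
    (zeta : dual (X * Y)%type) (alpha : dual X) (beta : dual Y),
  (forall x, alpha x = zeta (x, 0)) -> (forall y, beta y = zeta (0, y)) ->
  N (prod_set A B) p zeta -> N A p.1 alpha /\ N B p.2 beta.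
Hypothesis extremal_principle : forall (A B : set (X * Y)) a0 b0 (m r : R),
  closed A -> closed B -> A a0 -> B b0 ->
  0 < m -> m <= 4^-1 -> 0 < r -> r <= 1 -> `|a0 - b0| <= m * r / 64 ->
  (forall a, A a -> B a -> `|a - a0| <= r -> `|a - b0| <= r -> False) ->
  nearly_separated N A B a0 b0 m r.
Hypotheses (closed_Omega : closed Omega) (closed_gphF : closed (gph F)).
Hypotheses (Omega_xbar : Omega xbar) (F_ybar : F xbar ybar).
Hypotheses (delta_gt0 : 0 < delta) (L_O1 : O1 L ybar) (L_O5 : O5 L ybar).
Hypothesis ext : extremal L F Omega xbar ybar.

Lemma extremal_multipliers (m s : R) : 0 < m -> m <= 4^-1 -> 0 < s ->
  exists (x1 : X) (y1 : Y) (x2 : X) (y y2 : Y) (xi xi2 : dual X)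
      (ups zet : dual Y),
    [/\ `|x1 - xbar| < s /\ `|y1 - ybar| < s, `|x2 - xbar| < s,
      Lcirc L ybar y /\ `|y - ybar| < delta & `|y2 - ybar| < s] /\
    [/\ N (gph F) (x1, y1) (dual_pair xi ups), N Omega x2 xi2 &
      N (closure (L y)) y2 zet] /\
    [/\ `|xi + xi2| <= m, `|ups + zet| <= m, 2^-1 <= `|xi| + `|ups| &
      `|xi2| <= 2].
Proof.
move=> m0 m4 s0; have [rho rho0 rhoP] := extremal_radius ext.
pose r := Num.min 1 (Num.min (rho / 4) (s / 4)).
(* The bound [rho / 4] keeps common points inside the region of extremality; [s / 4] is needed
   because [y2] is near [v0], which is itself within [r] of [ybar]. *)
have r0 : 0 < r by rewrite lt_min ltr01 /= lt_min !divr_gt0.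
have r1 : r <= 1 by rewrite ge_min lexx.
have rrho : r <= rho / 4.
  by rewrite ge_min; apply/orP; right; rewrite ge_min lexx.
have rs : r <= s / 4.
  by rewrite ge_min; apply/orP; right; rewrite ge_min lexx orbT.
(* This puts [y] in the [delta]-ball and makes the distance of the two starting points as small as
   the extremal principle demands. *)
pose eta := Num.min delta (Num.min r (m * r / 64)).
have eta0 : 0 < eta.
  by rewrite lt_min delta_gt0 /= lt_min r0 /= divr_gt0// mulr_gt0.
have etad : eta <= delta by rewrite ge_min lexx.
have etar : eta <= r by rewrite ge_min; apply/orP; right; rewrite ge_min lexx.
have etam : eta <= m * r / 64.
  by rewrite ge_min; apply/orP; right; rewrite ge_min lexx orbT.
clearbody r eta.
have [y [v0 [Ly ye Lv ve]]] := O1_approx L_O1 eta0.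
have [||||[x1 y1] [[x2 y2] [alpha [beta [[ar br Na Nb] [abm a1 _ b2]]]]]] :=
  @extremal_principle (gph F) (prod_set Omega (closure (L y))) (xbar, ybar)
    (xbar, v0) m r closed_gphF _ F_ybar _ m0 m4 r0 r1.
- by apply: closed_prod_set => //; exact: closed_closure.
- by split=> //=; exact: subset_closure.
- rewrite prod_normE/= subrr normr0 max_r// distrC.
  exact: le_trans (ltW ve) etam.
- move=> [x y'] /= Fxy [/= Ox Ly']; rewrite prod_normE ge_max /= => /andP[xr yr] _.
  have r_rho : r < rho by lra.
  apply: (rhoP x y') => //; [exact: le_lt_trans r_rho|exact: le_lt_trans r_rho|].
  exact: L_O5 Ly'.
have [xi [ups [_ _ alphaE]]] := dual_components alpha.
have [xi2 [zet [xi2E zetE betaE]]] := dual_components beta.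
have [Nx2 Ny2] := normal_prod xi2E zetE Nb.
have dnorm (Z : normedModType R) (f : dual Z) z : `|f z| <= `|f| * `|z|.
  exact: dual_normP.
exists x1, y1, x2, y, y2, xi, xi2, ups, zet; split; [|split; split=> //].
- have r_s : r < s by lra.
  move: ar br; rewrite !prod_normE !ge_max /= => /andP[x1r y1r] /andP[x2r y2r].
  split; [split|..]; try exact: le_lt_trans r_s.
    by split=> //; exact: lt_le_trans etad.
  by apply: le_lt_trans (ler_distD v0 _ _) _; lra.
- suff <- : alpha = dual_pair xi ups by [].
  by apply/val_inj/funext => p; exact: alphaE.
- apply: le_trans abm; apply: dual_norm_le => x x1'.
  have -> : (xi + xi2) x = (alpha + beta) (x, 0) :> R.
    by rewrite !dualD alphaE betaE /= !dual_eval0 !addr0.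
  apply: le_trans (dnorm _ _ _) _; rewrite ler_piMr// prod_normE/= normr0.
  by rewrite (max_l (normr_ge0 x)).
- apply: le_trans abm; apply: dual_norm_le => x x1'.
  have -> : (ups + zet) x = (alpha + beta) (0, x) :> R.
    by rewrite !dualD alphaE betaE /= !dual_eval0 !add0r.
  apply: le_trans (dnorm _ _ _) _; rewrite ler_piMr// prod_normE/= normr0.
  by rewrite (max_r (normr_ge0 x)).
- apply: le_trans a1 _; apply: dual_norm_le => p p1; rewrite alphaE /=.
  apply: le_trans (ler_normD _ _) _; move: p1; rewrite prod_normE ge_max.
  move=> /andP[px py]; apply: lerD; apply: le_trans (dnorm _ _ _) _;
    by rewrite ler_piMr.
- apply: le_trans b2; apply: dual_norm_le => x x1'; rewrite xi2E.
  apply: le_trans (dnorm _ _ _) _; rewrite ler_piMr// prod_normE/= normr0.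
  by rewrite (max_l (normr_ge0 x)).
Qed.

Let nzt (Z : normedModType R) (f : dual Z) (t : R) : 0 < t ->
  `|t *: f| = t * `|f|.
Proof. by move=> t0; rewrite normrZ gtr0_norm. Qed.

Let coderivativeZ x1 y1 (xi : dual X) (ups : dual Y) (t : R) : 0 < t ->
  N (gph F) (x1, y1) (dual_pair xi ups) ->
  coderivative N F x1 y1 (- (t *: ups)) (t *: xi).
Proof.
move=> t0 Nxi; rewrite /coderivative /=.
suff -> : dual_pair (t *: xi) (- (- (t *: ups))) = t *: dual_pair xi ups.
  exact: normalZ.
apply/val_inj/funext => p; rewrite opprK.
rewrite -[LHS]/((t *: xi) p.1 + (t *: ups) p.2 : R).
by rewrite -[RHS]/(t * (xi p.1 + ups p.2) : R) mulrDr.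
Qed.

(** If [|ups| < c], then [|xi| + |xi2|] is at least 1/4. Normalising this sum to 1 multiplies by at
    most 4, so the scaled [ups] and [xi + xi2] have norm at most [e0 / 2], against the qualification
    condition. *)
Lemma QC_lower_bound e0 x1 y1 x2 (xi xi2 : dual X) (ups : dual Y) (c : R) :
  (forall x1 y1 x2 (x1s x2s : dual X),
    (gph F `&` ball (xbar, ybar) e0) (x1, y1) ->
    (Omega `&` ball xbar e0) x2 ->
    (\bigcup_(ys in ball (0 : dual Y) e0) coderivative N F x1 y1 ys) x1s ->
    N Omega x2 x2s -> `|x1s| + `|x2s| = 1 -> e0 <= `|x1s + x2s|) ->
  0 < e0 -> c <= 4^-1 -> c <= e0 / 8 ->
  (gph F `&` ball (xbar, ybar) e0) (x1, y1) ->
  (Omega `&` ball xbar e0) x2 ->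
  N (gph F) (x1, y1) (dual_pair xi ups) -> N Omega x2 xi2 ->
  `|xi + xi2| <= c -> 2^-1 <= `|xi| + `|ups| -> c <= `|ups|.
Proof.
move=> qc e00 c4 ce Bx1 Bx2 Nxi Nxi2 sum_xi alpha_ge.
rewrite leNgt; apply/negP => upsc.
have xi2_0 := normr_ge0 xi2; have ge14 : 4^-1 <= `|xi| + `|xi2|.
  lra.
have gt0 : 0 < `|xi| + `|xi2| by apply: lt_le_trans ge14; rewrite invr_gt0.
pose t := (`|xi| + `|xi2|)^-1.
have t0 : 0 < t by rewrite invr_gt0.
have t4 : t <= 4 by rewrite -[leRHS]invrK lef_pV2// posrE invr_gt0.
have := qc x1 y1 x2 (t *: xi) (t *: xi2) Bx1 Bx2.
rewrite -scalerDr !nzt// -mulrDr mulVf ?gt_eqF// => s1.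
have bs : (\bigcup_(ys in ball (0 : dual Y) e0) coderivative N F x1 y1 ys)
    (t *: xi).
  exists (- (t *: ups)); last exact: coderivativeZ.
  apply: dual_ball; rewrite normrN nzt//.
  apply: (@le_lt_trans _ _ (4 * (e0 / 8))); last lra.
  by apply: ler_pM => //; [exact: ltW|exact: le_trans (ltW upsc) ce].
move: (s1 bs (normalZ t0 Nxi2) erefl).
have : t * `|xi + xi2| <= 4 * (e0 / 8).
  by apply: ler_pM => //; [exact: ltW|exact: le_trans sum_xi ce].
lra.
Qed.

Lemma multiplier_rule : QC N F Omega xbar ybar ->
  exists2 M : R, 0 < M & forall eps : R, 0 < eps ->
     exists (x1 : X) (y1 : Y) (x2 : X) (y y2 : Y) (ys : dual Y),
       [/\ (gph F `&` ball (xbar, ybar) eps) (x1, y1),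
           (Omega `&` ball xbar eps) x2,
           (Lminus L ybar `&` ball ybar delta) y &
           (closure (L y) `&` ball ybar eps) y2] /\
       [/\ set_add (N (closure (L y)) y2) (ball 0 eps) ys,
           `|ys| = 1 &
           set_add
             (set_add (coderivative N F x1 y1 ys)
                      (N Omega x2 `&` ball 0 M))
             (ball 0 eps) 0].
Proof.
move=> [e0 e00 qc]; pose c := Num.min 4^-1 (e0 / 8).
have c0 : 0 < c by rewrite lt_min invr_gt0 ltr0n/= divr_gt0.
have c4 : c <= 4^-1 by rewrite ge_min lexx.
have ce : c <= e0 / 8 by rewrite ge_min lexx orbT.
(* Division by [|ups| >= c] turns the bound 2 on [|xi2|] into [2 / c]; 3 makes the inequality
   strict, and [c] depends on [e0] alone. *)
exists (3 / c); first by rewrite divr_gt0.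
(* The errors of size [m] become at most [eps / 2] after division by [|ups|]. *)
move=> eps eps0; pose m := Num.min c (eps * c / 2).
have m0 : 0 < m by rewrite lt_min c0 divr_gt0// mulr_gt0.
have mc : m <= c by rewrite ge_min lexx.
have me : m <= eps * c / 2 by rewrite ge_min lexx orbT.
pose s := Num.min eps e0.
have s0 : 0 < s by rewrite lt_min eps0.
have seps : s <= eps by rewrite ge_min lexx.
have se0 : s <= e0 by rewrite ge_min lexx orbT.
clearbody c m s.
have [x1 [y1 [x2 [y [y2 [xi [xi2 [ups [zet
    [[[x1s y1s] x2s [Ly yd] y2s] [[Nxi Nxi2 Nzet] [xi_m ups_m xi_ge xi2_le]]]]]]]]]]]] :=
  extremal_multipliers m0 (le_trans mc c4) s0.
have Bx1 e : s <= e -> (gph F `&` ball (xbar, ybar) e) (x1, y1).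
  move=> se; split; first exact: normal_mem Nxi.
  rewrite -ball_normE/= distrC prod_normE/= gt_max.
  by rewrite (lt_le_trans x1s se) (lt_le_trans y1s se).
have Bx2 e : s <= e -> (Omega `&` ball xbar e) x2.
  move=> se; split; first exact: normal_mem Nxi2.
  by rewrite -ball_normE/= distrC; exact: lt_le_trans se.
have ups_ge := QC_lower_bound qc e00 c4 ce (Bx1 _ se0) (Bx2 _ se0) Nxi Nxi2
  (le_trans xi_m mc) xi_ge.
have ups0 : 0 < `|ups| by exact: lt_le_trans ups_ge.
pose t := `|ups|^-1; have t0 : 0 < t by rewrite invr_gt0.
have tc : t <= c^-1 by rewrite lef_pV2// posrE.
have tm (Z : normedModType R) (f : dual Z) : `|f| <= m -> `|- (t *: f)| < eps.
  move=> fm; rewrite normrN nzt//; apply: (@le_lt_trans _ _ (c^-1 * m)).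
    by apply: ler_pM => //; exact: ltW.
  rewrite mulrC ltr_pdivrMr//; apply: le_lt_trans me _.
  by have := mulr_gt0 eps0 c0; lra.
(* The multiplier is [- ups] normalised; it differs from the normal [t *: zet] by the small
   functional [t *: (ups + zet)]. *)
exists x1, y1, x2, y, y2, (- (t *: ups)); split; split=> //.
- exact: Bx1.
- exact: Bx2.
- by case: Ly => Ly _; split; [left|rewrite -ball_normE/= distrC].
- split; first exact: normal_mem Nzet.
  by rewrite -ball_normE/= distrC; exact: lt_le_trans seps.
- exists (t *: zet); first exact: normalZ.
  exists (- (t *: (ups + zet))); first exact/dual_ball/tm.
  by rewrite scalerDr opprD addrCA subrr addr0.
- by rewrite normrN nzt// mulVf// gt_eqF.
- exists (t *: xi + t *: xi2).
    exists (t *: xi); first exact: coderivativeZ.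
    exists (t *: xi2) => //; split; first exact: normalZ.
    apply: dual_ball; rewrite nzt//; apply: (@le_lt_trans _ _ (c^-1 * 2)).
      by apply: ler_pM => //; exact: ltW.
    by rewrite mulrC ltr_pM2r ?invr_gt0// ltr_nat.
  exists (- (t *: (xi + xi2))); first exact/dual_ball/tm.
  by rewrite -scalerDr subrr.
Qed.

End rule.

End multipliers.

Unset Implicit Arguments.

Theorem corollary4p3 (R : realType) (X Y : completeNormedModType R)
    (Omega : set X) (F : X -> set Y) (L : Y -> set Y)
    (xbar : X) (ybar : Y) (delta : R)
    (closed_Omega : closed Omega) (closed_gphF : closed (gph F))
    (Omega_xbar : Omega xbar) (F_ybar : F xbar ybar) (delta_gt0 : 0 < delta)
    (L_O1 : O1 L ybar) (L_O5 : O5 L ybar) :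
  (QC (@clarke_normal R) F Omega xbar ybar ->
   extremal L F Omega xbar ybar ->
   exists2 M : R, 0 < M & forall eps : R, 0 < eps ->
     exists (x1 : X) (y1 : Y) (x2 : X) (y y2 : Y) (ys : dual Y),
       [/\ (gph F `&` ball (xbar, ybar) eps) (x1, y1),
           (Omega `&` ball xbar eps) x2,
           (Lminus L ybar `&` ball ybar delta) y &
           (closure (L y) `&` ball ybar eps) y2] /\
       [/\ set_add (clarke_normal (closure (L y)) y2) (ball 0 eps) ys,
           `|ys| = 1 &
           set_add
             (set_add (coderivative (@clarke_normal R) F x1 y1 ys)
                      (clarke_normal Omega x2 `&` ball 0 M))
             (ball 0 eps) 0])
  /\
  (asplund X -> asplund Y ->
   QC (@frechet_normal R) F Omega xbar ybar ->
   extremal L F Omega xbar ybar ->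
   exists2 M : R, 0 < M & forall eps : R, 0 < eps ->
     exists (x1 : X) (y1 : Y) (x2 : X) (y y2 : Y) (ys : dual Y),
       [/\ (gph F `&` ball (xbar, ybar) eps) (x1, y1),
           (Omega `&` ball xbar eps) x2,
           (Lminus L ybar `&` ball ybar delta) y &
           (closure (L y) `&` ball ybar eps) y2] /\
       [/\ set_add (frechet_normal (closure (L y)) y2) (ball 0 eps) ys,
           `|ys| = 1 &
           set_add
             (set_add (coderivative (@frechet_normal R) F x1 y1 ys)
                      (frechet_normal Omega x2 `&` ball 0 M))
             (ball 0 eps) 0]).
Proof.
have XYc : geo_complete (X * Y)%type.
  by apply: geo_complete_prod; exact: geo_complete_normed.
split=> [qc ext|aX aY qc ext]; apply: multiplier_rule => //.
- by move=> Z S z zs [].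
- exact: clarke_normalZ.
- exact: clarke_normal_prod.
- move=> A B a0 b0 m r cA cB Aa Bb m0 m4 r0 r1 ab disj.
  apply: clarke_separation => //; apply: le_trans ab _.
  by have := mulr_gt0 m0 r0; lra.
- by move=> Z S z zs [].
- exact: frechet_normalZ.
- exact: frechet_normal_prod.
- move=> A B a0 b0 m r; apply: frechet_separation => //.
  by apply: asp_prod; exact: asplund_asp.
Qed.
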